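(* Let $F$ be a nonabelian free group of rank at least $4$. Then the image of $F$ under $\mathrm{scl}$ in $\mathbb R/\mathbb Z$, that is, the set $\{\mathrm{scl}(g) \bmod \mathbb Z : g\in [F,F]\}$, is precisely $\mathbb Q/\mathbb Z$.
   Context: For a group $G$ and $g\in[G,G]$, $\mathrm{cl}(g)$ is the least number of commutators in $G$ whose product is $g$, and $\mathrm{scl}(g)=\lim_{n\to\infty}\mathrm{cl}(g^n)/n$. The image of a free group under $\mathrm{scl}$ means the set of (finite) values of $\mathrm{scl}$ on elements of its commutator subgroup. *)

(* Defs.v *)
From HB Require Import structures.
From mathcomp Require Import all_boot all_order all_algebra.
From mathcomp Require Import all_classical all_reals all_analysis.
Set Implicit Arguments.
Unset Strict Implicit.
Unset Printing Implicit Defensive.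
Import Order.TTheory GRing.Theory Num.Theory.
Import numFieldNormedType.Exports.

Local Open Scope classical_set_scope.
Local Open Scope group_scope.

(* [B] freely generates [F], by the universal property. A map on [B] is given
   as a map on all of [F], whose values outside [B] are never used. *)
Definition free_basis (F : groupType) (B : set F) : Prop :=
  forall (H : groupType) (f : F -> H),
    exists phi : {multiplicative F -> H},
      (forall x, B x -> phi x = f x) /\
      (forall psi : {multiplicative F -> H},
         (forall x, B x -> psi x = f x) -> psi =1 phi).

Definition subgroup_set (G : groupType) (H : set G) : Prop :=
  [/\ H 1,
      (forall x y, H x -> H y -> H (x * y)) &
      (forall x, H x -> H x^-1)].

Definition commutators (G : groupType) : set G :=
  [set [~ p.1, p.2] | p in [set: G * G]].

Definition commutator_subgroup (G : groupType) : set G :=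
  smallest (@subgroup_set G) (@commutators G).

Definition commutator_product (G : groupType) (n : nat) (g : G) : Prop :=
  exists s : n.-tuple (G * G), g = \prod_(p <- s) [~ p.1, p.2].

(* [cl g] is the genuine minimum when [g] is in the commutator subgroup, and by
   convention 0 otherwise. *)
Definition cl (G : groupType) (g : G) : nat :=
  xget 0%N [set n | commutator_product n g /\
                    forall m, commutator_product m g -> (n <= m)%N].

(* The term at [n = 0] is a junk value, irrelevant to the limit. *)
Definition scl (R : realType) (G : groupType) (g : G) : R :=
  limn (fun n : nat => ((cl (g ^+ n))%:R / n%:R)%R : R).

(* The quotient group R/Z. [Num.int_num_subdef] is the predicate underlying the
   qualifier [Num.int]; it is the one carrying the [zmodClosed] structure. *)
Definition RmodZ (R : realType) : zmodType :=
  Quotient.quot (GRing.ZmodClosed.clone R (@Num.int_num_subdef R) _).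

Definition toRmodZ (R : realType) (x : R) : RmodZ R := \pi_(RmodZ R)%qT x.

(* Main.v *)
Require Import Defs.
From HB Require Import structures.
From mathcomp Require Import all_boot all_order all_algebra.
From mathcomp Require Import all_classical all_reals all_analysis.
From mathcomp Require Import zify ring lra perm.
Import Order.TTheory GRing.Theory Num.Theory.
Import numFieldNormedType.Exports.

(* If [w] is a cyclically reduced word for [g], a product of [k] commutators
   equal to [g ^+ n] folds to a graph with a single boundary walk, which spells
   [w ^+ n]; the more vertices it has, the smaller [k] is. A vertex is a cycle of
   transitions between the letters of [w], so such a graph is a flow, closed up
   under [other_end]. These flows form a finitely generated monoid (Dickson's
   lemma), hence one of them has the best ratio of vertices to letters.
   Conversely every closed up flow is assembled to a ribbon graph, whose odd
   cyclic covers have connected boundary components and approach its Euler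
   characteristic, so that [scl g] is rational.

   For the other inclusion, [w = [~ a^-1, b^-1] * [~ a^-1, b ^+ q.+1]] has
   [scl w = 1 - 1 / (2 q)] when [2 <= q], so that [scl (w ^+ j)] is
   [j - j / (2 q)]. The upper bound is an explicit surface. For the lower bound,
   remove the edges [a] from a folded graph: on a component that is a tree the
   exponents [1] and [- q.+1] met around its boundary sum to zero, so most arcs of
   exponent [1], or most of exponent [-1], follow each other, and each time this
   happens a pairing of the same letter of [w] is used up. This bounds the
   number of trees, hence that of vertices. *)
Set Implicit Arguments.
Unset Strict Implicit.
Unset Printing Implicit Defensive.

Local Open Scope nat_scope.
Local Open Scope group_scope.

(** * Products of commutators *)

(** Surfaces enter only through their algebra. An upper bound on [scl g] is a family of commutator
    products equal to powers of [g], a lower bound is an inequality for all powers, and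
    [stable_bounds] packs both, so that a squeeze gives the existence of the limit together with its
    value. Odd exponents come from the pair of pants: in the cyclic cover of degree $N$ that sends
    two boundary loops to $1 \in \mathbb Z/N$, the third goes to $2$, and it lifts to a single loop
    exactly when $N$ is odd. Lower bounds rest on Euler's formula $|s| + 2 \le 2V + 4k$ for $k$
    commutators whose folded graph has $V$ vertices and $|s|$ darts, so everything amounts to
    bounding $V$. The obstacle is that infinitely many shapes of vertices occur. Splitting a vertex
    flow into basis elements can only increase the number of vertices, so finitely many shapes
    suffice. With $q = 2D$ the values $j - j/(4D)$, for $j$ divisible by $4$, meet every class of
    $\frac1D\mathbb Z$ modulo $\mathbb Z$. *)

Section CommutatorProducts.
Variable G : groupType.
Implicit Types (x y z g h t : G) (m n k : nat).

Definition gsimpl := (@invgM G, @invgK G, @mulgA G, @mulgK G, @mulgVK G,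
  @mulgV G, @mulVg G, @mul1g G, @mulg1 G, @invg1 G).

Lemma commutator_product0 : commutator_product 0 (1 : G).
Proof. by exists [tuple]; rewrite big_nil. Qed.

Lemma commutator_productM m n x y :
  commutator_product m x -> commutator_product n y ->
  commutator_product (m + n) (x * y).
Proof.
by move=> [s ->] [t ->]; exists [tuple of s ++ t]; rewrite big_cat.
Qed.

Lemma commutator_product1 x y : commutator_product 1 [~ x, y].
Proof. by exists [tuple (x, y)]; rewrite big_seq1. Qed.

Lemma commutator_product_le m n x :
  (m <= n)%N -> commutator_product m x -> commutator_product n x.
Proof.
elim: n => [|n IH]; first by rewrite leqn0 => /eqP ->.
rewrite leq_eqVlt => /predU1P[-> //|]; rewrite ltnS => /IH/[apply] cx.
have := commutator_productM cx (commutator_product1 (1 : G) 1).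
by rewrite commgg mulg1 addn1.
Qed.

Lemma commutator_productV n x :
  commutator_product n x -> commutator_product n x^-1.
Proof.
move=> [s ->]; elim: n s => [|n IH] s.
  by rewrite tuple0 big_nil invg1; apply: commutator_product0.
case/tupleP: s => p s /=; rewrite big_cons invgM invgR -addn1.
exact: commutator_productM (IH _) (commutator_product1 _ _).
Qed.

Lemma commutator_productJ n x g :
  commutator_product n x -> commutator_product n (x ^ g).
Proof.
move=> [s ->]; rewrite conjg_prod; elim: n s => [|n IH] s.
  by rewrite tuple0 big_nil; apply: commutator_product0.
case/tupleP: s => p s /=; rewrite big_cons conjRg -add1n.
exact: commutator_productM (commutator_product1 _ _) (IH _).
Qed.

Lemma commutator_productX n j x :
  commutator_product n x -> commutator_product (j * n) (x ^+ j).
Proof.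
move=> cx; elim: j => [|j IH]; first exact: commutator_product0.
by rewrite expgS mulSn; apply: commutator_productM.
Qed.

Lemma commutator_subgroupP g :
  commutator_subgroup g <-> exists n, commutator_product n g.
Proof.
split=> [cg|[n [s ->]] H [[H1 HM HV] sCH]].
  apply: (cg [set h | exists n, commutator_product n h]%classic); split.
    split; first by exists 0%N; apply: commutator_product0.
    - by move=> x y [m cx] [n cy]; exists (m + n)%N; apply: commutator_productM.
    by move=> x [m cx]; exists m; apply: commutator_productV.
  by move=> _ [[x y] _ <-]; exists 1%N; apply: commutator_product1.
elim: n s => [|n IH] s; first by rewrite tuple0 big_nil.
case/tupleP: s => p s /=; rewrite big_cons; apply: HM => //.
by apply: sCH; exists p.
Qed.

Lemma cl_le n g : commutator_product n g -> (cl g <= n)%N.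
Proof.
move=> cg; rewrite /cl; case: xgetP => // k _ [_ /(_ _ cg)] //.
Qed.

Lemma commutator_product_cl g :
  commutator_subgroup g -> commutator_product (cl g) g.
Proof.
move/commutator_subgroupP => [n cg]; rewrite /cl.
have exP : exists m, `[< commutator_product m g >] by exists n; apply/asboolP.
case: xgetP => [k _ [] //|/(_ (ex_minn exP)) []].
case: ex_minnP => m /asboolP cm mmin; split=> // j cj.
by apply: mmin; apply/asboolP.
Qed.

(* [x] and [y] differ by at most [n] commutators. *)
Definition commutator_near n x y := commutator_product n (x * y^-1).

Lemma near_refl x : commutator_near 0 x x.
Proof. by rewrite /commutator_near mulgV; apply: commutator_product0. Qed.

Lemma near_sym n x y : commutator_near n x y -> commutator_near n y x.
Proof.
by move/commutator_productV; rewrite invgM invgK.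
Qed.

Lemma near_trans m n x y z :
  commutator_near m x y -> commutator_near n y z -> commutator_near (m + n) x z.
Proof.
move=> a b; have := commutator_productM a b.
by rewrite /commutator_near mulgA mulgVK.
Qed.

Lemma nearM m n x y x' y' :
  commutator_near m x x' -> commutator_near n y y' ->
  commutator_near (m + n) (x * y) (x' * y').
Proof.
rewrite addnC => a /(commutator_productJ x^-1) b.
have := commutator_productM b a.
by rewrite /commutator_near conjgE !gsimpl.
Qed.

Lemma nearMl n g x y :
  commutator_near n x y -> commutator_near n (g * x) (g * y).
Proof. exact: nearM (near_refl g). Qed.

Lemma nearMr n g x y :
  commutator_near n x y -> commutator_near n (x * g) (y * g).
Proof. by move=> h; rewrite -[n]addn0; apply: nearM (near_refl g). Qed.

Lemma near_conj x g : commutator_near 1 (x ^ g) x.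
Proof.
rewrite /commutator_near conjgE -[_ * _^-1]/(g^-1 * (x * g) * x^-1).
have -> : g^-1 * (x * g) * x^-1 = [~ g, x^-1]; last exact: commutator_product1.
by rewrite commgEl conjgE !gsimpl.
Qed.

(** Both sides are a conjugate of [t] times the same element, and two conjugates of [t] differ by
    one commutator. *)
Lemma near_move a b t a' b' :
  a * b = a' * b' -> commutator_near 1 (a * t * b) (a' * t * b').
Proof.
move=> e.
have -> : a * t * b = t ^ a^-1 * (a * b) by rewrite conjgE !gsimpl.
have -> : a' * t * b' = t ^ a'^-1 * (a' * b') by rewrite conjgE !gsimpl.
rewrite e; apply: nearMr.
have -> : t ^ a^-1 = (t ^ a'^-1) ^ (a' * a^-1) by rewrite !conjgE !gsimpl.
exact: near_conj.
Qed.

Lemma commutator_product_near m n x y :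
  commutator_near m x y -> commutator_product n y ->
  commutator_product (m + n) x.
Proof.
by move=> a b; have := commutator_productM a b; rewrite mulgVK.
Qed.

(** At each induction step the last even factor moves past all the odd ones, for a single commutator
    whatever their number. *)
Lemma near_shuffle (t : nat -> G) m :
  commutator_near m
    (\prod_(0 <= i < m.+1) t i.*2 * \prod_(0 <= i < m) t i.*2.+1)
    (\prod_(0 <= i < m.*2.+1) t i).
Proof.
elim: m => [|m IH].
  by rewrite !big_nat1 big_geq // mulg1; apply: near_refl.
have -> : \prod_(0 <= i < m.+1.*2.+1) t i =
    \prod_(0 <= i < m.*2.+1) t i * t m.*2.+1 * t m.*2.+2.
  by rewrite doubleS big_nat_recr //= big_nat_recr.
have -> : \prod_(0 <= i < m.+2) t i.*2 =
    \prod_(0 <= i < m.+1) t i.*2 * t m.*2.+2 by rewrite big_nat_recr //= doubleS.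
have -> : \prod_(0 <= i < m.+1) t i.*2.+1 =
    \prod_(0 <= i < m) t i.*2.+1 * t m.*2.+1 by rewrite big_nat_recr.
rewrite -[m.+1]add1n.
apply: (near_trans (y := \prod_(0 <= i < m.+1) t i.*2 *
  (\prod_(0 <= i < m) t i.*2.+1 * t m.*2.+1) * t m.*2.+2 * 1)).
  by apply: near_move; rewrite mulg1.
rewrite mulg1 !mulgA; do 2![apply: nearMr]; exact: IH.
Qed.

(* In an odd cyclic cover both generators of the thrice-punctured sphere group,
   and their product, lift to single loops; [near_expgM] is that surface. With
   [t k = b^(a^-k) a^-1], the powers of [b] run through all the [t k] in order,
   those of [b * a] through the even ones and then the odd ones. *)
Lemma near_expgM (b a : G) m :
  commutator_near m.+1 ((b * a) ^+ m.*2.+1) (b ^+ m.*2.+1 * a ^+ m.*2.+1).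
Proof.
pose t k := a ^+ k * b * (a ^+ k.+1)^-1.
have tE k : a ^+ k * b = t k * a ^+ k.+1 by rewrite /t mulgVK.
have bE c j : a ^+ c * b ^+ j = (\prod_(0 <= i < j) t (c + i)%N) * a ^+ (c + j).
  elim: j c => [|j IH] c; first by rewrite big_geq // mul1g mulg1 addn0.
  rewrite expgS mulgA tE -mulgA IH mulgA big_nat_recl // addn0 addSnnS.
  by congr (_ * _ * _); apply: eq_bigr => i _; congr t; lia.
have baE c j : a ^+ c * (b * a) ^+ j =
    (\prod_(0 <= i < j) t (c + i.*2)%N) * a ^+ (c + j.*2).
  elim: j c => [|j IH] c; first by rewrite big_geq // mul1g mulg1 addn0.
  rewrite expgS !mulgA tE -(mulgA _ (a ^+ c.+1) a) -expgSr -mulgA IH mulgA.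
  rewrite big_nat_recl // addn0 doubleS !addnS !addSn.
  by congr (_ * _ * _); apply: eq_bigr => i _; congr t; lia.
set n := m.*2.+1; set z := a ^+ n.
(* Since [n] is odd, the even indices beyond [n] are [n] plus an odd index, so up to conjugation by
   [z] they run through the odd factors. *)
have tz i : t (n + i)%N = z * t i * z^-1.
  by rewrite /t -addnS !expgnDr -/z !gsimpl.
have := bE 0%N n; rewrite expg0 mul1g add0n -/z => ->.
have := baE 0%N n; rewrite expg0 mul1g add0n => ->.
have -> : n.*2 = (n + n)%N by rewrite addnn.
rewrite expgnDr -/z !mulgA; apply: nearMr.
have -> : \prod_(0 <= i < n) t i.*2 = \prod_(0 <= i < m.+1) t i.*2 * z *
    \prod_(0 <= i < m) t i.*2.+1 * z^-1.
  rewrite (big_cat_nat (n := m.+1)) //=; last by rewrite /n; lia.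
  rewrite -!mulgA; congr (_ * _).
  rewrite -{1}[m.+1]add0n big_addn (_ : n - m.+1 = m)%N; last by rewrite /n; lia.
  have -> : z * (\prod_(0 <= i < m) t i.*2.+1 * z^-1) =
      (\prod_(0 <= i < m) t i.*2.+1) ^ z^-1 by rewrite conjgE !gsimpl.
  rewrite conjg_prod; apply: eq_bigr => i _.
  have -> : (i + m.+1).*2 = (n + i.*2.+1)%N by rewrite /n; lia.
  by rewrite tz conjgE !gsimpl.
rewrite mulgVK -add1n.
apply: (near_trans (y := \prod_(0 <= i < m.+1) t i.*2 *
  \prod_(0 <= i < m) t i.*2.+1 * z)).
  rewrite -[X in commutator_near _ _ X]mulg1.
  by apply: near_move; rewrite mulg1.
exact/nearMr/near_shuffle.
Qed.

End CommutatorProducts.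

(** * Euler characteristics of chains *)

Section ChainBounds.
Variable G : groupType.
Implicit Types (x y z g h : G) (m n k e : nat) (s t : seq G).

(* A bound [- chi <= e] for the chain [s]: up to a constant, the product of the
   [N]-th powers is a product of [N * e / 2] commutators, for odd [N]. *)
Definition chain_bound s e := exists C, forall m,
  commutator_product (m * e + C) (\prod_(g <- s) g ^+ m.*2.+1).

Lemma chain_bound_le s e e' : (e <= e')%N -> chain_bound s e -> chain_bound s e'.
Proof.
move=> le [C b]; exists C => m; apply: commutator_product_le (b m).
by rewrite leq_add2r leq_mul2l le orbT.
Qed.

Lemma chain_bound_near s t e d C :
  (forall m, commutator_near (m * d + C) (\prod_(g <- s) g ^+ m.*2.+1)
                             (\prod_(g <- t) g ^+ m.*2.+1)) ->
  chain_bound t e -> chain_bound s (e + d).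
Proof.
move=> near [C' b]; exists (C + C')%N => m.
apply: commutator_product_le (commutator_product_near (near m) (b m)).
by rewrite mulnDr; lia.
Qed.

(** The constant has to be uniform in [f]: the lemma is applied to all the power maps at once, while
    [chain_bound] allows a single [C]. *)
Lemma near_perm_prod s t : perm_eq s t -> exists C, forall f : G -> G,
  commutator_near C (\prod_(g <- s) f g) (\prod_(g <- t) f g).
Proof.
elim: t s => [|x t IH] s pst.
  by rewrite (perm_nilP pst); exists 0%N => f; apply: near_refl.
have xs : x \in s by rewrite (perm_mem pst) mem_head.
case/splitPr: xs pst => s1 s2; rewrite -cat1s perm_catCA perm_cons => /IH[C b].
exists (1 + C)%N => f; rewrite big_cat !big_cons /= mulgA.
apply: (near_trans (y := f x * (\prod_(g <- s1) f g * \prod_(g <- s2) f g))).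
  by have := near_move (f x) (esym (mul1g (\prod_(g <- s1) f g *
    \prod_(g <- s2) f g))); rewrite mul1g.
by rewrite -big_cat /=; apply: nearMl.
Qed.

Lemma chain_bound_perm s t e : perm_eq s t -> chain_bound t e -> chain_bound s e.
Proof.
move=> /near_perm_prod[C b]; rewrite -[e in X in _ -> X]addn0.
by apply: (chain_bound_near (C := C)) => m; rewrite muln0.
Qed.

Lemma chain_bound_conj g h s e :
  chain_bound (g :: s) e -> chain_bound (g ^ h :: s) e.
Proof.
rewrite -[e in X in _ -> X]addn0.
apply: (chain_bound_near (C := 1)) => m; rewrite muln0 !big_cons -conjXg.
exact/nearMr/near_conj.
Qed.

Lemma chain_bound_rot g h s e :
  chain_bound (h * g :: s) e -> chain_bound (g * h :: s) e.
Proof.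
by move=> /(chain_bound_conj g^-1); rewrite conjgE !gsimpl.
Qed.

(** Gluing a pair of pants, of Euler characteristic $-1$, with boundary [g * h], [g], [h].
    [chain_bound_join] glues the same surface the other way round. *)
Lemma chain_bound_split g h s e :
  chain_bound (g :: h :: s) e -> chain_bound (g * h :: s) e.+1.
Proof.
rewrite -[e.+1]addn1; apply: (chain_bound_near (C := 1)) => m.
rewrite muln1 addn1 !big_cons mulgA; exact/nearMr/near_expgM.
Qed.

Lemma chain_bound_join g h s e :
  chain_bound (g * h :: s) e -> chain_bound (g :: h :: s) e.+1.
Proof.
rewrite -[e.+1]addn1; apply: (chain_bound_near (C := 1)) => m.
rewrite muln1 addn1 !big_cons mulgA; exact/nearMr/near_sym/near_expgM.
Qed.

(** Here $(gh)^N = g^N h^N$ holds exactly, so the step is free. *)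
Lemma chain_bound_commute g h s e : commute g h ->
  chain_bound (g * h :: s) e -> chain_bound (g :: h :: s) e.
Proof.
move=> cgh [C b]; exists C => m; have := b m.
by rewrite !big_cons mulgA expgMn.
Qed.

Lemma chain_bound1 s e : chain_bound s e -> chain_bound (1 :: s) e.
Proof. by move=> [C b]; exists C => m; rewrite big_cons expg1n mul1g. Qed.

Lemma chain_boundV g s e : chain_bound s e -> chain_bound (g :: g^-1 :: s) e.
Proof.
move=> b; apply: chain_bound_commute; first by rewrite /commute mulgV mulVg.
by rewrite mulgV; apply: chain_bound1.
Qed.

Lemma chain_bound_nil : chain_bound [::] 0.
Proof. by exists 0%N => m; rewrite big_nil muln0; apply: commutator_product0. Qed.

Lemma chain_bound_drop1 s e : chain_bound (1 :: s) e -> chain_bound s e.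
Proof.
by move=> [C b]; exists C => m; have := b m; rewrite big_cons expg1n mul1g.
Qed.

Lemma chain_bound_conjs (I : Type) (r : seq I) (f c : I -> G) e :
  chain_bound [seq f i | i <- r] e -> chain_bound [seq f i ^ c i | i <- r] e.
Proof.
suff H t : chain_bound ([seq f i | i <- r] ++ t) e ->
    chain_bound ([seq f i ^ c i | i <- r] ++ t) e.
  by move=> b; have := H [::]; rewrite !cats0; apply.
elim: r t => //= i r IH t b; apply: chain_bound_conj.
apply: (chain_bound_perm (t := [seq f i ^ c i | i <- r] ++ f i :: t)).
  exact/permPl/(perm_catCA [:: _]).
apply: IH; apply: chain_bound_perm b; rewrite perm_sym.
exact/permPl/(perm_catCA [:: _]).
Qed.

End ChainBounds.

(** * Ribbon graphs and the chains that they bound *)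

Section Walks.
Variables (D : Type) (T : eqType) (v : D -> T) (tau : D -> D).

(* A dart [d] is an oriented edge from [v d] to [v (tau d)]. *)
Fixpoint walk (x : T) (s : seq D) (y : T) : bool :=
  if s is d :: s' then (v d == x) && walk (v (tau d)) s' y else x == y.

Lemma walk_cat x s t y :
  walk x (s ++ t) y <-> exists2 z, walk x s z & walk z t y.
Proof.
elim: s x => [|d s IH] x /=.
  by split=> [w|[z /eqP->]//]; exists x.
split=> [/andP[vd /IH[z w w']]|[z /andP[-> w] w']]; last by apply/IH; exists z.
by exists z => //; rewrite vd.
Qed.

End Walks.

Section RibbonGraphs.
Variables (G : groupType) (D T : eqType) (tau : D -> D).
Implicit Types (v : D -> T) (lab : D -> G) (s : seq D) (ss : seq (seq D)).

Definition word lab s := \prod_(d <- s) lab d.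

Lemma word_cat lab s t : word lab (s ++ t) = word lab s * word lab t.
Proof. exact: big_cat. Qed.

Lemma word_cons lab d s : word lab (d :: s) = lab d * word lab s.
Proof. exact: big_cons. Qed.

(* The words [ss] bound a surface that retracts onto the graph of darts: they
   are closed walks that use each dart exactly once. *)
Definition ribbon_graph v lab ss :=
  [/\ uniq (flatten ss),
      {in flatten ss, forall d,
        [/\ tau d \in flatten ss, tau (tau d) = d, tau d != d &
            lab (tau d) = (lab d)^-1]},
      {in ss, forall s, exists x, walk v tau x s x} &
      {in flatten ss, forall d, 2 <= count (fun x => v x == v d) (flatten ss)}%N].

Definition vertex_count v s := size (undup (map v s)).

Lemma perm_filter_pair s d d' : uniq s -> d \in s -> d' \in s -> d' != d ->
  perm_eq s [:: d, d' & [seq x <- s | x \notin [:: d; d']]].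
Proof.
move=> us ds d's d'd; apply: uniq_perm => //=.
  apply/and3P; split; last exact: filter_uniq.
    by rewrite inE negb_or eq_sym d'd mem_filter inE eqxx.
  by rewrite mem_filter !inE eqxx orbT.
move=> x; rewrite !inE mem_filter !inE.
by case: eqP => [->|_] //=; case: eqP => [->|].
Qed.

(** This is the reason for two darts at each vertex in [ribbon_graph]: $V - E$ is then never
    positive, a case that a bound [e] in [nat] could not record. *)
Lemma double_vertex_count_le v s :
  {in s, forall d, 2 <= count (fun x => v x == v d) s}%N ->
  ((vertex_count v s).*2 <= size s)%N.
Proof.
move=> val2; have -> : size s = \sum_(u <- undup (map v s)) count_mem u (map v s).
  rewrite -(size_map v) -(perm_size (perm_count_undup (map v s))) size_flatten.
  rewrite sumnE /shape -map_comp big_map; apply: eq_bigr => u _ /=.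
  by rewrite size_nseq.
rewrite /vertex_count -muln2 mulnC -sum1_size big_distrr /=.
rewrite big_seq [X in (_ <= X)%N]big_seq; apply: leq_sum => u.
rewrite mem_undup => /mapP[d ds ->]; rewrite count_map muln1; exact: val2.
Qed.

(** The factors at inner vertices telescope, so that on a closed walk a change of gauge is a
    conjugation. *)
Lemma word_gauge v lab (g : T -> G) x s y : walk v tau x s y ->
  word (fun d => (g (v d))^-1 * lab d * g (v (tau d))) s =
  (g x)^-1 * word lab s * g y.
Proof.
elim: s x => [|d s IH] x /=; first by move/eqP->; rewrite /word !big_nil !gsimpl.
by move=> /andP[/eqP<- /IH e]; rewrite !word_cons e !gsimpl.
Qed.



(** A gauge at the far vertex makes the label of [d] trivial; then [d] and [tau d] are erased from
    the walks and their ends identified. Boundary words change only by conjugation, and $V - E$ does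
    not decrease. *)
Lemma contract_edge v lab ss d e : ribbon_graph v lab ss -> d \in flatten ss ->
  v d != v (tau d) ->
  exists v' lab' ss', [/\ ribbon_graph v' lab' ss',
    size (flatten ss) = (size (flatten ss')).+2,
    (vertex_count v (flatten ss) <= (vertex_count v' (flatten ss')).+1)%N &
    chain_bound [seq word lab' s | s <- ss'] e ->
    chain_bound [seq word lab s | s <- ss] e].
Proof.
move=> [us Htau closed val2] dss neq.
have [tdss tdK tdd labtd] := Htau d dss.
pose P x := x \notin [:: d; tau d].
pose v' x := if v x == v (tau d) then v d else v x.
pose g u : G := if u == v (tau d) then (lab d)^-1 else 1.
pose lab' x := (g (v x))^-1 * lab x * g (v (tau x)).
set fl := flatten ss in us Htau closed val2 dss tdss *.
have perm_fl : perm_eq fl [:: d, tau d & seq.filter P fl] by exact: perm_filter_pair.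
have Fss : flatten (map (seq.filter P) ss) = seq.filter P fl by rewrite filter_flatten.
have v'P x : ~~ P x -> v' x = v' (tau x).
  rewrite /P negbK !inE => /orP[]/eqP-> ; rewrite /v' ?tdK eqxx.
    by rewrite (negPf neq).
  by rewrite (negPf neq).
have lab'P x : ~~ P x -> lab' x = 1.
  rewrite /P negbK !inE => /orP[]/eqP-> ; rewrite /lab' /g ?tdK eqxx (negPf neq).
    by rewrite !gsimpl.
  by rewrite labtd !gsimpl.
have countE (Q : pred D) : count Q fl = (Q d + Q (tau d) + count Q (seq.filter P fl))%N.
  by rewrite (seq.permP perm_fl) /= addnA.
have count_gt0 u : u \in [:: v d; v (tau d)] ->
    (0 < count (fun x => v x == u) (seq.filter P fl))%N.
  rewrite !inE => /orP[]/eqP->.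
    by have := val2 _ dss; rewrite countE eqxx eq_sym (negPf neq).
  by have := val2 _ tdss; rewrite countE eqxx (negPf neq).
exists v', lab', (map (seq.filter P) ss); split.
- split; rewrite ?Fss.
  + exact: filter_uniq.
  + move=> x; rewrite mem_filter => /andP[Px /Htau[txs txK txx labt]].
    rewrite mem_filter txs andbT; split=> //; last first.
      by rewrite /lab' txK labt !gsimpl.
    apply: contra Px; rewrite !inE => /orP[]/eqP E.
      by rewrite -E txK eqxx orbT.
    by rewrite -[x]txK E tdK eqxx.
  + move=> _ /mapP[s /closed[x w] ->].
    pose m u := if u == v (tau d) then v d else u.
    exists (m x); elim: s x {1 3}x w => [|y s IH] x z /=; first by move/eqP->.
    move=> /andP[/eqP<- w]; case: ifP => [_|/negbT Py] /=; first by rewrite eqxx IH.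
    by have := IH _ _ w; rewrite -[m (v (tau y))]/(v' (tau y)) -v'P.
  + move=> x; rewrite mem_filter => /andP[Px xs].
    have [xdd|xdd] := boolP (v x \in [:: v d; v (tau d)]).
      have -> : v' x = v d.
        by rewrite /v'; move: xdd; rewrite !inE => /orP[]/eqP->; rewrite ?eqxx ?(negPf neq).
      (* The merged vertex keeps two darts: each end of the edge had one besides [d] or [tau d]. *)
      have := leq_add (count_gt0 (v d) _) (count_gt0 (v (tau d)) _).
      rewrite !inE !eqxx orbT => /(_ isT isT) /leq_trans; apply.
      rewrite -count_predUI [X in (_ + X)%N](_ : _ = 0%N) ?addn0; last first.
        apply/eqP; rewrite -leqn0 leqNgt -has_count; apply/hasPn => y _ /=.
        by apply/negP => /andP[/eqP->]; rewrite (negPf neq).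
      apply: sub_count => y /= /orP[]/eqP E; rewrite /v' E ?eqxx //.
      by rewrite (negPf neq).
    have v'x y : (v' y == v' x) = (v y == v x).
      move: xdd; rewrite /v' !inE negb_or => /andP[xd xtd].
      rewrite (negPf xtd); case: ifP => // /eqP->.
      by rewrite eq_sym (negPf xd) eq_sym (negPf xtd).
    rewrite (eq_count v'x); have := val2 _ xs; rewrite countE.
    move: xdd; rewrite !inE negb_or eq_sym [in X in _ && X]eq_sym.
    by move=> /andP[/negPf-> /negPf->].
- by rewrite Fss (perm_size perm_fl).
- rewrite Fss; set V := undup (map v fl).
  suff le : (size (rem (v (tau d)) V) <= vertex_count v' (seq.filter P fl))%N.
    move: le; rewrite size_rem ?mem_undup ?map_f // /(vertex_count v fl) -/V.
    by lia.
  apply: uniq_leq_size; first by rewrite rem_uniq // undup_uniq.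
  move=> u; rewrite mem_rem_uniq ?undup_uniq // inE !mem_undup => /andP[utd].
  case/mapP=> x xs uE; apply/mapP.
  have [ud|ud] := eqVneq u (v d).
    have := count_gt0 (v d); rewrite !inE eqxx -has_count => /(_ isT) /hasP[y ys /eqP yE].
    by exists y => //; rewrite /v' yE (negPf neq).
  exists x; last by rewrite /v' -uE (negPf utd).
  rewrite mem_filter xs andbT /P !inE; apply/norP; split.
    by apply: contraNneq ud => <-; rewrite uE.
  by apply: contraNneq utd => <-; rewrite uE.
- pose c s : G := if s is x :: _ then g (v x) else 1.
  rewrite -map_comp => /(chain_bound_conjs (fun s => (c s)^-1)).
  congr chain_bound; apply/eq_in_map => s /closed[x w] /=.
  have -> : word lab' (seq.filter P s) = word lab' s.
    by rewrite /word big_filter big_rmcond.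
  rewrite (word_gauge lab g w) conjgE invgK.
  case: s w => [|y s] /= => [_|/andP[/eqP <- _]]; last by rewrite !gsimpl.
  by rewrite /word big_nil !gsimpl.
Qed.

Lemma walk_loops v x s y : {in s, forall d, v (tau d) = v d} ->
  walk v tau x s y -> y = x /\ {in s, forall d, v d = x}.
Proof.
elim: s x => [|d s IH] x loop /=; first by move/eqP->.
move=> /andP[/eqP vd w].
have [] := IH _ (fun z zs => loop z (@mem_behead _ (d :: s) z zs)) w.
rewrite loop ?mem_head // vd => -> vs; split=> // z.
by rewrite inE => /predU1P[->//|/vs].
Qed.

Lemma loops_walk v x s : {in s, forall d, v (tau d) = v d /\ v d = x} ->
  walk v tau x s x.
Proof.
elim: s => //= d s IH loop; have [-> vd] := loop d (mem_head _ _).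
by rewrite vd eqxx IH // => z zs; apply: loop; rewrite inE zs orbT.
Qed.

(** If one walk contains both [d] and [tau d], deleting them cuts it in two; otherwise it merges two
    walks. Either way a pair of pants is paid for. In the last clause the loop is alone at its
    vertex, where the walks spell [g] and its inverse, or their trivial product, for free. *)
Lemma delete_loop v lab ss d : ribbon_graph v lab ss -> d \in flatten ss ->
  {in flatten ss, forall x, v (tau x) = v x} ->
  exists ss', [/\ perm_eq (flatten ss) [:: d, tau d & flatten ss'],
    {in ss', forall s, exists x, {in s, forall y, v y = x}},
    forall e, chain_bound [seq word lab s | s <- ss'] e ->
      chain_bound [seq word lab s | s <- ss] e.+1 &
    forall e, {in flatten ss', forall x, v x != v d} ->
      chain_bound [seq word lab s | s <- ss'] e ->
      chain_bound [seq word lab s | s <- ss] e].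
Proof.
move=> [us Htau closed val2] dss loop.
have [tdss tdK tdd labtd] := Htau d dss.
have const s : s \in ss -> exists x, {in s, forall y, v y = x}.
  move=> sss; have [x w] := closed s sss; exists x.
  have loops y : y \in s -> v (tau y) = v y.
    by move=> ys; apply: loop; apply/flattenP; exists s.
  by have [] := walk_loops loops w.
have [sd sdss dsd] := flattenP dss.
have psd := perm_to_rem sdss; set ss1 := rem sd ss in psd.
have const1 s : s \in ss1 -> exists x, {in s, forall y, v y = x}.
  by move=> s1; apply: const; apply: mem_rem s1.
have := perm_flatten psd; rewrite /= => pfl.
have pch e : chain_bound [seq word lab s | s <- sd :: ss1] e ->
    chain_bound [seq word lab s | s <- ss] e.
  by apply: chain_bound_perm; apply: perm_map.
have [xd cd] := const _ sdss; have xdE := cd _ dsd.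
case/splitPr: dsd pfl pch cd => s1 s2 pfl pch cd.
have {}pch e : chain_bound (lab d * word lab (s2 ++ s1) :: map (word lab) ss1) e ->
    chain_bound [seq word lab s | s <- ss] e.
  move=> b; apply: pch; rewrite /= word_cat word_cons.
  by apply: chain_bound_rot; rewrite -mulgA -word_cat.
have {}pfl : perm_eq (flatten ss) (d :: (s2 ++ s1) ++ flatten ss1).
  apply: perm_trans pfl _; rewrite -cat_cons perm_cat2r.
  by rewrite perm_catC.
have {}cd : {in s2 ++ s1, forall y, v y = xd}.
  move=> y ys; apply: cd; move: ys; rewrite !mem_cat inE.
  by case/orP=> ->; rewrite ?orbT.
move: (s2 ++ s1) => s in pfl pch cd *.
have : tau d \in d :: s ++ flatten ss1 by rewrite -(perm_mem pfl).
rewrite inE (negPf tdd) /= mem_cat => /orP[tds|/flattenP[t tss1 tdt]].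
  case/splitPr: tds pfl pch cd => u1 u2 pfl pch cd.
  exists [:: u1, u2 & ss1]; split=> [|s0|e b|e vd b].
  - rewrite (permPl pfl) /= perm_cons -catA.
    by apply/permPl/(perm_catCA u1 [:: tau d] (u2 ++ flatten ss1)).
  - rewrite !inE => /or3P[/eqP->|/eqP->|/const1//]; exists xd => y ys; apply: cd.
      by rewrite mem_cat ys.
    by rewrite mem_cat inE ys !orbT.
  - apply: pch; rewrite word_cat word_cons labtd !mulgA.
    apply: chain_bound_split.
    by have := chain_bound_conj (lab d)^-1 b; rewrite conjgE !gsimpl.
  - move: b => /= b; apply: pch; rewrite word_cat word_cons labtd.
    have nil u : {subset u <= u1 ++ u2} -> u = [::].
      case: u => // y u sub; have /sub yu := mem_head y u.
      have := vd y; rewrite /= catA mem_cat yu => /(_ isT) /negP[].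
      rewrite xdE cd //; move: yu; rewrite !mem_cat inE.
      by case/orP=> ->; rewrite ?orbT.
    have u1E : u1 = [::] by apply: nil => y yu; rewrite mem_cat yu.
    have u2E : u2 = [::] by apply: nil => y yu; rewrite mem_cat yu orbT.
    move: b; rewrite u1E u2E /word big_nil !gsimpl.
    exact: chain_bound_drop1.
have pt := perm_to_rem tss1; set ss2 := rem t ss1 in pt.
have const2 s0 : s0 \in ss2 -> exists x, {in s0, forall y, v y = x}.
  by move=> s1'; apply: const1; apply: mem_rem s1'.
have := perm_flatten pt; rewrite /= => pfl1.
have [xt ct] := const1 _ tss1; have xtE := ct _ tdt.
case/splitPr: tdt pfl1 pt ct => t1 t2 pfl1 pt ct.
have pch' e : chain_bound (word lab (s ++ t2 ++ t1) :: map (word lab) ss2) e ->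
    chain_bound [seq word lab s | s <- ss] e.+1.
  move=> b; apply: pch; apply: chain_bound_rot.
  apply: (chain_bound_perm (t := (word lab t1 * (lab d)^-1 * word lab t2)
      :: (word lab s * lab d) :: map (word lab) ss2)).
    apply: (perm_trans (y := [:: word lab s * lab d,
        word lab t1 * (lab d)^-1 * word lab t2 & map (word lab) ss2])).
      rewrite perm_cons; have := perm_map (word lab) pt.
      by rewrite /= word_cat word_cons labtd mulgA.
    exact/permPl/(perm_catCA [:: _] [:: _]).
  rewrite -mulgA; apply: chain_bound_rot.
  apply: (chain_bound_perm (t := (word lab s * lab d)
      :: ((lab d)^-1 * word lab t2 * word lab t1) :: map (word lab) ss2)).
    exact/permPl/(perm_catCA [:: _] [:: _]).
  by apply: chain_bound_join; rewrite !mulgA mulgK -mulgA -!word_cat.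
have {}pfl : perm_eq (flatten ss) [:: d, tau d & (s ++ t2 ++ t1) ++ flatten ss2].
  apply: perm_trans pfl _; rewrite perm_cons.
  apply: (perm_trans (y := s ++ (tau d :: t2 ++ t1) ++ flatten ss2)).
    rewrite perm_cat2l; apply: perm_trans pfl1 _; rewrite perm_cat2r.
    by rewrite perm_catC.
  rewrite -catA; exact/permPl/(perm_catCA s [:: tau d]).
exists [:: s ++ t2 ++ t1 & ss2]; split=> [//|s0|e b|e vd b].
- rewrite inE => /predU1P[->|/const2//]; exists xd => y.
  rewrite mem_cat => /orP[ys|yt]; first exact: cd.
  rewrite ct; first by rewrite -xtE loop.
  by move: yt; rewrite !mem_cat inE => /orP[]->; rewrite ?orbT.
- exact: pch'.
- have nil : s ++ t2 ++ t1 = [::].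
    case E : (s ++ _) => [//|y u].
    have yu : y \in s ++ t2 ++ t1 by rewrite E mem_head.
    have := vd y; rewrite /= mem_cat yu => /(_ isT) /negP[].
    rewrite xdE; move: yu; rewrite mem_cat => /orP[ys|yt]; first by rewrite cd.
    rewrite ct; first by rewrite -xdE -xtE loop.
    by move: yt; rewrite !mem_cat inE => /orP[]->; rewrite ?orbT.
  apply: pch; have -> : word lab s = 1.
    by case: (s) nil => // _; rewrite /word big_nil.
  rewrite mulg1; apply: (chain_bound_perm (t := [:: lab d, (lab d)^-1 &
      map (word lab) ss2])).
    rewrite perm_cons; have := perm_map (word lab) pt.
    rewrite /= word_cat word_cons labtd.
    have -> : t1 = [::] by case: (t1) nil => //; case: (s) => //; case: (t2).
    have -> : t2 = [::] by case: (t2) nil => //; case: (s).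
    by rewrite /word !big_nil !gsimpl.
  apply: chain_boundV; move: b; rewrite /= nil /word big_nil.
  exact: chain_bound_drop1.
Qed.

(* Edges between distinct vertices are contracted, and loops deleted one by one
   until a single one is left at each vertex, where the boundary is a pair
   [g, g^-1]. *)
Theorem ribbon_graph_bound v lab ss e : ribbon_graph v lab ss ->
  (size (flatten ss) <= (vertex_count v (flatten ss) + e).*2)%N ->
  chain_bound [seq word lab s | s <- ss] e.
Proof.
have [n] := ubnP (size (flatten ss)); elim: n v lab ss e => // n IH v lab ss e.
rewrite ltnS => le_n rg.
have [/hasP[d dss neq]|/hasPn loops] := boolP (has (fun x => v x != v (tau x)) (flatten ss)).
  have [v' [lab' [ss' [rg' sz vc tr]]]] := contract_edge e rg dss neq.
  by move=> le; apply: tr; apply: IH rg' _; lia.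
have loop : {in flatten ss, forall x, v (tau x) = v x}.
  by move=> x /loops; rewrite negbK => /eqP.
case E : (flatten ss) => [|d fl] le.
  have -> : [seq word lab s | s <- ss] = nseq (size ss) 1.
    elim: (ss) E => //= s ss' IHs; case: s => //= E; rewrite -IHs //.
    by rewrite /word big_nil.
  apply: (chain_bound_le (e := 0)) => //.
  elim: (size ss) => [|k IHk] /=; [exact: chain_bound_nil|exact: chain_bound1].
have dss : d \in flatten ss by rewrite E mem_head.
have [ss' [perm_fl const tr1 tr0]] := delete_loop rg dss loop.
rewrite -E in le => {E fl}.
have [us Htau _ val2] := rg; have [tdss tdK tdd _] := Htau d dss.
have sub x : x \in flatten ss' -> x \in flatten ss.
  by rewrite (perm_mem perm_fl) !inE => ->; rewrite !orbT.
have us' : uniq [:: d, tau d & flatten ss'] by rewrite -(perm_uniq perm_fl).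
have notd x : x \in flatten ss' -> (x != d) && (x != tau d).
  move=> xs; apply/andP; split; apply: contraTneq xs => ->.
    by case/andP: us'; rewrite inE negb_or => /andP[].
  by case/and3P: us'.
have tau' x : x \in flatten ss' -> tau x \in flatten ss'.
  move=> xs; have [txs txK _ _] := Htau _ (sub _ xs).
  have /andP[xd xtd] := notd _ xs.
  move: txs; rewrite (perm_mem perm_fl) !inE => /or3P[/eqP e'|/eqP e'|//].
    by rewrite -txK e' eqxx in xtd.
  by rewrite -txK e' tdK eqxx in xd.
have rg' : ribbon_graph v lab ss'.
  split.
  - by case/and3P: us'.
  - by move=> x xs; have [? ? ? ?] := Htau _ (sub _ xs); split=> //; apply: tau'.
  - move=> s sss; have [x cx] := const s sss; exists x.
    apply: loops_walk => y ys; split; last exact: cx.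
    by apply: loop; apply: sub; apply/flattenP; exists s.
  - move=> x xs; have [txs txK txx _] := Htau _ (sub _ xs).
    have ufl : uniq (flatten ss') by case/and3P: us'.
    rewrite (seq.permP (perm_filter_pair ufl xs (tau' _ xs) txx)) /=.
    by rewrite loop ?eqxx //; apply: sub.
have sz : size (flatten ss) = (size (flatten ss')).+2 by rewrite (perm_size perm_fl).
have [/hasP[x xs /eqP vx]|/hasPn novd] := boolP (has (fun x => v x == v d) (flatten ss')).
  have vcE : vertex_count v (flatten ss) = vertex_count v (flatten ss').
    apply/eqP; rewrite eq_sym -uniq_size_uniq ?undup_uniq // => u.
    rewrite !mem_undup; apply/mapP/mapP => [[y ys ->]|[y ys ->]].
      move: ys; rewrite (perm_mem perm_fl) !inE => /or3P[/eqP->|/eqP->|ys].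
      - by exists x.
      - by exists x => //; rewrite loop.
      - by exists y.
    by exists y => //; apply: sub.
  (* Another loop survives at this vertex, so no vertex is lost, and [double_vertex_count_le] for
     the smaller graph excludes [e = 0]. *)
  case: e le => [|e] le.
    have [_ _ _ /double_vertex_count_le] := rg'.
    by lia.
  by apply: tr1; apply: IH rg' _; lia.
apply: tr0 => //; apply: IH rg' _; first by lia.
have : (vertex_count v (flatten ss) <= (vertex_count v (flatten ss')).+1)%N.
  rewrite -[_.+1]/(size (v d :: undup (map v (flatten ss')))).
  apply: uniq_leq_size; first exact: undup_uniq.
  move=> u; rewrite inE !mem_undup => /mapP[y ys ->].
  move: ys; rewrite (perm_mem perm_fl) !inE => /or3P[/eqP->|/eqP->|ys].
  - by rewrite eqxx.
  - by rewrite loop // eqxx.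
  - by rewrite map_f ?orbT.
by lia.
Qed.


End RibbonGraphs.

(** * Words in a basis *)

Section Bijections.
Variable X : Type.

(** The group to which the universal property is applied in order to let a free group act on
    words. *)
Record bijection := Bijection {
  bij_fun :> X -> X; bij_inv : X -> X;
  bij_funK : cancel bij_fun bij_inv; bij_invK : cancel bij_inv bij_fun }.

HB.instance Definition _ := gen_eqMixin bijection.
HB.instance Definition _ := gen_choiceMixin bijection.

Lemma bijectionP (f g : bijection) : f =1 g -> f = g.
Proof.
case: f g => [f f' fK f'K] [g g' gK g'K] /= /funext fg; subst g.
have fg' : f' = g' by apply/funext => x; rewrite -{1}(g'K x) fK.
by subst g'; congr Bijection; apply: Prop_irrelevance.
Qed.

Definition bijection1 := @Bijection id id (frefl _) (frefl _).
Definition bijectionM (f g : bijection) :=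
  Bijection (can_comp (bij_funK f) (bij_funK g))
            (can_comp (bij_invK g) (bij_invK f)).
Definition bijectionV (f : bijection) := Bijection (bij_invK f) (bij_funK f).

Fact bijectionA : associative bijectionM.
Proof. by move=> f g h; apply: bijectionP. Qed.
Fact bijection1M : left_id bijection1 bijectionM.
Proof. by move=> f; apply: bijectionP. Qed.
Fact bijectionM1 : right_id bijection1 bijectionM.
Proof. by move=> f; apply: bijectionP. Qed.
Fact bijectionVM : left_inverse bijection1 bijectionV bijectionM.
Proof. by move=> f; apply: bijectionP => x /=; rewrite bij_funK. Qed.
Fact bijectionMV : right_inverse bijection1 bijectionV bijectionM.
Proof. by move=> f; apply: bijectionP => x /=; rewrite bij_invK. Qed.

HB.instance Definition _ := isGroup.Build bijection
  bijectionA bijection1M bijectionM1 bijectionVM bijectionMV.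

End Bijections.

Section Multiplicative.
Variables (G H : groupType) (f : {multiplicative G -> H}).

Lemma multiplicative1 : f 1 = 1.
Proof. by apply: (@mulgI _ (f 1)); rewrite -gmulfM !mulg1. Qed.

Lemma multiplicativeV x : f x^-1 = (f x)^-1.
Proof. by apply: (@mulgI _ (f x)); rewrite -gmulfM !mulgV multiplicative1. Qed.

End Multiplicative.

Section FreeWords.
Variable F : groupType.

(* [(x, true)] stands for [x] and [(x, false)] for its inverse. *)
Definition letter : eqType := (F * bool)%type.
Implicit Types (l a b : letter) (w u : seq letter).

Definition linv l : letter := (l.1, ~~ l.2).
Definition lval l : F := if l.2 then l.1 else l.1^-1.
Definition wval w := \prod_(l <- w) lval l.

Lemma linvK : involutive linv.
Proof. by case=> x b; rewrite /linv /= negbK. Qed.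

Lemma lval_inv l : lval (linv l) = (lval l)^-1.
Proof. by case: l => x []; rewrite /lval /= ?invgK. Qed.

Lemma wval_cat w u : wval (w ++ u) = wval w * wval u.
Proof. exact: big_cat. Qed.

Lemma wval_cons l w : wval (l :: w) = lval l * wval w.
Proof. exact: big_cons. Qed.

Lemma wval_inv w : wval (rev (map linv w)) = (wval w)^-1.
Proof.
elim: w => [|l w IH]; first by rewrite /wval big_nil invg1.
rewrite map_cons rev_cons -cats1 wval_cat IH (wval_cons l) invgM.
by rewrite /wval big_seq1 lval_inv.
Qed.

Definition reduced w := sorted (fun a b => b != linv a) w.

Definition push a w :=
  if w is b :: w' then if b == linv a then w' else a :: w else [:: a].

Lemma reduced_push a w : reduced w -> reduced (push a w).
Proof.
case: w => //= b w; case: eqP => [_|/eqP ab] /=; last by rewrite ab.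
by case: w => //= c w /andP[].
Qed.

Lemma push_linv a w : reduced w -> push (linv a) (push a w) = w.
Proof.
case: w => [|b w] /=; first by rewrite linvK eqxx.
case: eqP => [->|/eqP ab] /=; last by rewrite linvK eqxx.
by case: w => //= c w /andP[/negPf-> _].
Qed.

(** Words that are not reduced stay fixed, which makes [act a] a bijection of the whole type of
    words. *)
Definition act a w := if reduced w then push a w else w.

Lemma act_linv a : cancel (act a) (act (linv a)).
Proof.
move=> w; rewrite /act; case: (boolP (reduced w)) => [rw|/negPf-> //].
by rewrite reduced_push // push_linv.
Qed.

Lemma act_linvV a : cancel (act (linv a)) (act a).
Proof. by move=> w; rewrite -{1}[a]linvK act_linv. Qed.

Definition act_bij (x : F) : bijection (seq letter) :=
  Bijection (act_linv (x, true)) (act_linvV (x, true)).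

Variable B : set F.
Hypothesis B_free : free_basis B.

Definition over_basis w := forall l, l \in w -> B l.1.

Lemma over_basis_cat w u : over_basis (w ++ u) <-> over_basis w /\ over_basis u.
Proof.
split=> [wu | [ow ou] l]; last by rewrite mem_cat => /orP[/ow|/ou].
by split=> l lw; apply: wu; rewrite mem_cat lw ?orbT.
Qed.

(* The free group acts on the set of all words, through the reduced ones. *)
Lemma wval_inj w u : over_basis w -> over_basis u -> reduced w -> reduced u ->
  wval w = wval u -> w = u.
Proof.
have [phi [phiE _]] := B_free act_bij.
have phiw w' : over_basis w' -> reduced w' -> phi (wval w') [::] = w'.
  elim: w' => [|a w' IH] ow rw; first by rewrite /wval big_nil multiplicative1.
  have rw' : reduced w' by move: rw; rewrite /reduced; case: (w') => //= b w'' /andP[].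
  have ow' : over_basis w' by move=> l lw; apply: ow; rewrite inE lw orbT.
  rewrite wval_cons gmulfM /= IH //.
  have -> : phi (lval a) =1 act a.
    have Ba := ow a (mem_head _ _).
    case: a Ba {ow rw} => x [] /= Bx y; rewrite /lval /=; first by rewrite phiE.
    by rewrite multiplicativeV phiE.
  rewrite /act rw'; move: rw; rewrite /reduced /push.
  by case: (w') => //= b w'' /andP[/negPf->].
by move=> ow ou rw ru e; rewrite -(phiw w) // e phiw.
Qed.


Definition spanned g := exists2 w, over_basis w & g = wval w.

Lemma spanned1 : spanned 1.
Proof. by exists [::] => //; rewrite /wval big_nil. Qed.

Lemma spannedM g h : spanned g -> spanned h -> spanned (g * h).
Proof.
move=> [w ow ->] [u ou ->]; exists (w ++ u); first exact/over_basis_cat.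
by rewrite wval_cat.
Qed.

Lemma over_basis_inv w : over_basis w -> over_basis (rev (map linv w)).
Proof. by move=> ow l; rewrite mem_rev => /mapP[b /ow Bb ->]. Qed.

Lemma spannedV g : spanned g -> spanned g^-1.
Proof.
move=> [w /over_basis_inv ow ->]; exists (rev (map linv w)) => //.
by rewrite wval_inv.
Qed.

Record span := Span { span_val :> F; spanP : spanned span_val }.

HB.instance Definition _ := gen_eqMixin span.
HB.instance Definition _ := gen_choiceMixin span.

Lemma span_val_inj : injective span_val.
Proof.
by case=> g gP [h hP] /= gh; subst h; congr Span; apply: Prop_irrelevance.
Qed.

Definition span1 := Span spanned1.
Definition spanM (g h : span) := Span (spannedM (spanP g) (spanP h)).
Definition spanV (g : span) := Span (spannedV (spanP g)).

Fact spanA : associative spanM.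
Proof. by move=> f g h; apply: span_val_inj; apply: mulgA. Qed.
Fact span1M : left_id span1 spanM.
Proof. by move=> f; apply: span_val_inj; apply: mul1g. Qed.
Fact spanM1 : right_id span1 spanM.
Proof. by move=> f; apply: span_val_inj; apply: mulg1. Qed.
Fact spanVM : left_inverse span1 spanV spanM.
Proof. by move=> f; apply: span_val_inj; apply: mulVg. Qed.
Fact spanMV : right_inverse span1 spanV spanM.
Proof. by move=> f; apply: span_val_inj; apply: mulgV. Qed.

HB.instance Definition _ := isGroup.Build span spanA span1M spanM1 spanVM spanMV.

Lemma spanned_basis x : B x -> spanned x.
Proof.
move=> Bx; exists [:: (x, true)]; last by rewrite /wval big_seq1.
by move=> l; rewrite inE => /eqP->.
Qed.

Fact span_valM : {morph span_val : g h / g * h}.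
Proof. by []. Qed.
HB.instance Definition _ := isMultiplicative.Build span F span_val span_valM.

(** The universal property maps the group to [span]. Followed by the inclusion, this map is the
    identity on [B], hence everywhere by uniqueness. *)
Lemma basis_spans g : spanned g.
Proof.
pose f x : span := if pselect (B x) is left Bx then Span (spanned_basis Bx) else 1.
have [phi [phiE _]] := B_free f.
have [idphi [_ uniq_id]] := B_free (@id F).
have psiM : {morph (fun x => span_val (phi x)) : x y / x * y}.
  by move=> x y; rewrite !gmulfM.
pose psi : {multiplicative F -> F} :=
  HB.pack (fun x => span_val (phi x)) (isMultiplicative.Build _ _ _ psiM).
have idM : {morph (@id F) : x y / x * y} by [].
pose idf : {multiplicative F -> F} := HB.pack (@id F) (isMultiplicative.Build _ _ _ idM).
have psiE : psi =1 idf.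
  move=> x; rewrite (uniq_id psi) ?(uniq_id idf) // => y By.
  rewrite /psi /= phiE // /f; case: pselect => //.
by have := psiE g; rewrite /psi /idf /= => <-; apply: spanP.
Qed.

End FreeWords.

(** * Folding *)

Section Folding.
Variables (F : groupType) (D T : eqType) (lab : D -> letter F).
Implicit Types (tau : D -> D) (v : D -> T) (x : T) (s : seq D).

(* A closed walk based at [x] running once through each dart of a graph. *)
Definition pairing tau v x s :=
  [/\ uniq s,
      {in s, forall d, [/\ tau d \in s, tau (tau d) = d, tau d != d &
        lab (tau d) = linv (lab d)]} &
      walk v tau x s x].

(** The base point is listed separately because the graph of an empty walk still has one vertex. *)
Definition based_vertex_count v x s := size (undup (x :: map v s)).

Lemma walk_start tau v x s y : walk v tau x s y -> x \in y :: map v s.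
Proof.
case: s => [|d s] /=; first by move/eqP->; rewrite mem_head.
by case/andP=> /eqP-> _; rewrite !inE eqxx orbT.
Qed.

(** At most the tip [v (tau d)] disappears together with the edge. *)
Lemma cancel_backtrack tau v x s1 s2 d : pairing tau v x (s1 ++ d :: tau d :: s2) ->
  pairing tau v x (s1 ++ s2) /\
  (based_vertex_count v x (s1 ++ d :: tau d :: s2)
     <= (based_vertex_count v x (s1 ++ s2)).+1)%N.
Proof.
set s := s1 ++ _ => -[us Htau w].
have ds : d \in s by rewrite mem_cat mem_head orbT.
have [tds tdK tdd _] := Htau d ds.
have perm_s : perm_eq s [:: d, tau d & s1 ++ s2].
  exact/permPl/(perm_catCA s1 [:: d; tau d]).
have us' : uniq [:: d, tau d & s1 ++ s2] by rewrite -(perm_uniq perm_s).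
have [z w1] : exists2 z, walk v tau x s1 z & walk v tau z (d :: tau d :: s2) x.
  by have /walk_cat := w.
rewrite /= tdK => /and3P[/eqP vd /eqP vtd w2].
split.
  split; first by case/and3P: us'.
    move=> e es; have es' : e \in s by rewrite (perm_mem perm_s) !inE es !orbT.
    have [tes teK tee labe] := Htau e es'; split=> //.
    move: tes; rewrite (perm_mem perm_s) !inE => /or3P[/eqP te|/eqP te|//].
      by case/and3P: us' => _ /negP[]; rewrite -te teK.
    case/and3P: us'; rewrite inE negb_or => /andP[_ /negP[]].
    by rewrite -tdK -te teK.
  by apply/walk_cat; exists z => //; rewrite -vd.
rewrite -[_.+1]/(size (v (tau d) :: undup (x :: map v (s1 ++ s2)))).
apply: uniq_leq_size; first exact: undup_uniq.
move=> u; rewrite inE !mem_undup !inE => /predU1P[->|]; first by rewrite eqxx orbT.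
case/mapP=> e; rewrite (perm_mem perm_s) !inE => /or3P[/eqP->|/eqP->|es] ->.
- have := walk_start w2; rewrite inE map_cat mem_cat => /orP[->|->]; by rewrite !orbT.
- by rewrite eqxx.
- by rewrite map_f ?orbT.
Qed.

(* Stallings folding of the edges [tau d] and [d'], which start at the same
   vertex and carry the same letter. *)
Lemma fold_edges tau v x s1 s2 d d' : pairing tau v x (s1 ++ d :: d' :: s2) ->
  lab d' = linv (lab d) -> d' != tau d ->
  exists tau' v' x', pairing tau' v' x' (s1 ++ s2) /\
  (based_vertex_count v x (s1 ++ d :: d' :: s2)
     <= (based_vertex_count v' x' (s1 ++ s2)).+1)%N.
Proof.
set s := s1 ++ _ => -[us Htau w] labd' neq.
have ds : d \in s by rewrite mem_cat mem_head orbT.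
have d's : d' \in s by rewrite mem_cat !inE eqxx !orbT.
have [tds tdK tdd labtd] := Htau d ds.
have [td's td'K td'd' labtd'] := Htau d' d's.
have perm_s : perm_eq s [:: d, d' & s1 ++ s2].
  exact/permPl/(perm_catCA s1 [:: d; d']).
have us' : uniq [:: d, d' & s1 ++ s2] by rewrite -(perm_uniq perm_s).
have dd' : d != d' by case/andP: us'; rewrite inE negb_or => /andP[].
have td'd : tau d' != d by apply: contra neq => /eqP <-; rewrite td'K.
have [z w1] : exists2 z, walk v tau x s1 z & walk v tau z (d :: d' :: s2) x.
  by have /walk_cat := w.
move=> /= /and3P[/eqP vd /eqP vd' w2].
(* Folding identifies the far ends of the two edges, and [tau'] pairs the two darts that are left of
   them. *)
pose m u := if u == v (tau d') then v d else u.
pose tau' e := if e == tau d then tau d' else if e == tau d' then tau d else tau e.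
have rest e : e \in s -> e != d -> e != d' -> e \in s1 ++ s2.
  by rewrite (perm_mem perm_s) !inE => /or3P[->|->|].
have rest_s e : e \in s1 ++ s2 -> e \in s.
  by rewrite (perm_mem perm_s) !inE => ->; rewrite !orbT.
have restN e : e \in s1 ++ s2 -> (e != d) && (e != d').
  move=> es; apply/andP; split; apply: contraTneq es => ->.
    by case/andP: us'; rewrite inE negb_or => /andP[].
  by case/and3P: us'.
have tdrest : tau d \in s1 ++ s2 by apply: rest => //; rewrite eq_sym.
have td'rest : tau d' \in s1 ++ s2 by apply: rest.
have tneq : tau d' != tau d.
  by apply: contra dd' => /eqP e; rewrite -tdK -e td'K.
exists tau', (m \o v), (m x); split; first split.
- by case/and3P: us'.
- move=> e es; rewrite /tau'.
  have [->|etd] := eqVneq e (tau d).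
    rewrite (negPf tneq) eqxx; split=> //.
    by rewrite labtd' labtd labd' linvK.
  have [->|etd'] := eqVneq e (tau d').
    rewrite eqxx; split=> //; first by rewrite eq_sym.
    by rewrite labtd' labtd labd' linvK.
  have [tes teK tee labe] := Htau e (rest_s _ es).
  have /andP[ed ed'] := restN _ es.
  have te1 : tau e != tau d by apply: contra ed => /eqP te; rewrite -teK te tdK.
  have te2 : tau e != tau d' by apply: contra ed' => /eqP te; rewrite -teK te td'K.
  rewrite (negPf te1) (negPf te2); split=> //; apply: rest => //.
    by apply: contra etd => /eqP <-; rewrite teK.
  by apply: contra etd' => /eqP <-; rewrite teK.
- have mtau e : e \in s1 ++ s2 -> m (v (tau' e)) = m (v (tau e)).
    move=> es; rewrite /tau'; case: eqP => [->|_].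
      by rewrite tdK /m eqxx; case: ifP.
    by case: eqP => [->|//]; rewrite td'K vd'.
  have walk_m y s0 y' : {subset s0 <= s1 ++ s2} -> walk v tau y s0 y' ->
      walk (m \o v) tau' (m y) s0 (m y').
    elim: s0 y => [|e s0 IH] y sub /=; first by move/eqP->.
    move=> /andP[/eqP<-]; rewrite eqxx mtau ?sub ?mem_head //; apply: IH.
    by move=> e' e's; apply: sub; rewrite inE e's orbT.
  apply/walk_cat; exists (m z).
    by apply: walk_m w1 => e es; rewrite mem_cat es.
  have -> : m z = m (v (tau d')) by rewrite /m eqxx -vd; case: ifP.
  by apply: walk_m w2 => e es; rewrite mem_cat es orbT.
set V := undup (x :: map v s).
have r_in : v (tau d') \in V by rewrite mem_undup inE map_f ?orbT.
suff le : (size (rem (v (tau d')) V) <= based_vertex_count (m \o v) (m x) (s1 ++ s2))%N.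
  by rewrite size_rem // -ltnS in le; apply: leq_trans (leqSpred _) le.
apply: uniq_leq_size; first by rewrite rem_uniq // undup_uniq.
move=> u; rewrite mem_rem_uniq ?undup_uniq // inE !mem_undup => /andP[ur].
have mu : m u = u by rewrite /m (negPf ur).
rewrite !inE => /predU1P[ux|/mapP[e es ue]]; first by rewrite -ux mu eqxx.
apply/orP; right; apply/mapP.
have [ed|ed] := eqVneq e d.
  by exists (tau d') => //=; rewrite /m eqxx ue ed.
have [ed'|ed'] := eqVneq e d'.
  by exists (tau d) => //=; rewrite -vd' -ed' -ue mu.
by exists e; [apply: rest|rewrite /= -ue mu].
Qed.

(** Each move deletes two darts and at most one vertex, so $2V - |s|$ never decreases. *)
Lemma fold_reduced tau v x s : pairing tau v x s ->
  exists tau' v' x' s', [/\ pairing tau' v' x' s', reduced (map lab s'),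
    {subset s' <= s}, wval (map lab s') = wval (map lab s) &
    (size s' + (based_vertex_count v x s).*2
      <= size s + (based_vertex_count v' x' s').*2)%N].
Proof.
have [n] := ubnP (size s); elim: n tau v x s => // n IH tau v x s.
rewrite ltnS => le_n ps.
have [rs|nrs] := boolP (reduced (map lab s)); first by exists tau, v, x, s; split.
have [s1 [d [d' [s2 [sE labd']]]]] : exists s1 d d' s2,
    s = s1 ++ d :: d' :: s2 /\ lab d' = linv (lab d).
  elim: s nrs {le_n ps} => // d [//|d' s] IHs.
  rewrite /reduced /= negb_and negbK => /orP[/eqP labd'|nrs].
    by exists [::], d, d', s.
  have [s1 [e [e' [s2 [-> labe']]]]] := IHs nrs.
  by exists (d :: s1), e, e', s2.
have [tau' [v' [x' [ps' le]]]] : exists tau' v' x', pairing tau' v' x' (s1 ++ s2) /\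
  (based_vertex_count v x s <= (based_vertex_count v' x' (s1 ++ s2)).+1)%N.
  rewrite sE in ps *; have [e|neq] := eqVneq d' (tau d); last exact: fold_edges ps labd' neq.
  by exists tau, v, x; move: ps; rewrite e; apply: cancel_backtrack.
have sz : size s = (size (s1 ++ s2)).+2 by rewrite sE !size_cat /= !addnS.
have [|tau'' [v'' [x'' [s'' [ps'' rs'' sub wE le'']]]]] := IH _ _ _ _ _ ps'.
  by rewrite sz in le_n; exact: leq_trans le_n.
exists tau'', v'', x'', s''; split=> //.
- move=> e /sub; rewrite sE !mem_cat !inE => /orP[->|->]; by rewrite ?orbT.
- rewrite wE sE !map_cat !wval_cat /= !wval_cons labd' lval_inv.
  by rewrite mulVKg.
- by move: le le'' sz; clear; move: (based_vertex_count v x s); lia.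
Qed.

End Folding.

(** * The graph of a product of commutators *)

Section CommutatorGraph.
Variables (F : groupType) (W : nat * bool -> seq (letter F)) (n : nat).
Implicit Types (q : nat * bool) (i j : nat).

(* The loops [(i, false)] and [(i, true)] of a rose spell the two entries of the
   [i]-th commutator. The dart [(q, e, j)] is the [j]-th edge of the loop [q],
   run forwards if [e] and backwards otherwise; [None] is the center. *)
Definition rose_dart : eqType := (nat * bool * bool * nat)%type.
Definition rose_vertex : eqType := option (nat * bool * nat).

Definition rose_point q j : rose_vertex :=
  if (j == 0%N) || (j == size (W q)) then None else Some (q, j).

Definition rose_flip (d : rose_dart) : rose_dart := (d.1.1, ~~ d.1.2, d.2).

Definition rose_src (d : rose_dart) : rose_vertex :=
  rose_point d.1.1 (d.2 + ~~ d.1.2)%N.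

Definition rose_label (d : rose_dart) : letter F :=
  let l := nth (1 : F, true) (W d.1.1) d.2 in if d.1.2 then l else linv l.

(** The order of the loops spells $x^{-1} y^{-1} x y$, which is [[~ x, y]]. *)
Definition rose_segments : seq (nat * bool * bool) :=
  [seq (i, k.1, k.2) | i <- iota 0 n,
     k <- [:: (false, false); (true, false); (false, true); (true, true)]].

Definition segment_indices (p : nat * bool * bool) : seq nat :=
  let s := iota 0 (size (W p.1)) in if p.2 then s else rev s.

Definition rose_walk : seq rose_dart :=
  [seq (p, j) | p <- rose_segments, j <- segment_indices p].

Lemma mem_rose_segments q e : ((q, e) \in rose_segments) = (q.1 < n)%N.
Proof.
apply/allpairsPdep/idP => [[i [k [iin kin [-> _]]]]|qn].
  by move: iin; rewrite mem_iota.
exists q.1, (q.2, e); rewrite mem_iota qn; split=> //; last by case: (q).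
by case: (q.2); case: e.
Qed.

Lemma mem_rose_walk (d : rose_dart) :
  (d \in rose_walk) = (d.1.1.1 < n)%N && (d.2 < size (W d.1.1))%N.
Proof.
case: d => -[q e] j /=; apply/allpairsPdep/andP => [[p [k [pin kin e']]]|[qn jW]].
  move: e' pin kin => [<- <-]; rewrite mem_rose_segments => ->.
  by rewrite /segment_indices /=; case: ifP; rewrite ?mem_rev mem_iota.
exists (q, e), j; rewrite mem_rose_segments; split=> //.
by rewrite /segment_indices /=; case: ifP; rewrite ?mem_rev mem_iota.
Qed.

Lemma rose_flipK : involutive rose_flip.
Proof. by case=> [[q e] j]; rewrite /rose_flip /= negbK. Qed.

Lemma uniq_rose_walk : uniq rose_walk.
Proof.
apply: allpairs_uniq_dep; last by move=> [p j] [p' j'] _ _ /= [-> ->].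
  apply: allpairs_uniq_dep; rewrite ?iota_uniq //.
  by move=> [i [a b]] [i' [a' b']] _ _ /= [-> -> ->].
by move=> p _; rewrite /segment_indices; case: ifP; rewrite ?rev_uniq iota_uniq.
Qed.

Lemma walk_rev (D T : eqType) (v : D -> T) tau x s y : involutive tau ->
  walk v tau x s y -> walk v tau y (rev (map tau s)) x.
Proof.
move=> tauK; elim: s x => [|d s IH] x /=; first by rewrite eq_sym.
move=> /andP[/eqP<- /IH w]; rewrite rev_cons -cats1.
by apply/walk_cat; exists (v (tau d)); rewrite //= tauK !eqxx.
Qed.

Lemma walk_segment p :
  walk rose_src rose_flip None [seq (p, j) | j <- segment_indices p] None.
Proof.
case: p => q e.
have fwd : walk rose_src rose_flip None [seq (q, true, j) | j <- iota 0 (size (W q))] None.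
  have pt0 : None = rose_point q 0 by [].
  have ptN : None = rose_point q (0 + size (W q)) by rewrite /rose_point eqxx orbT.
  rewrite {1}pt0 ptN; elim: (size (W q)) 0%N => [|k IH] j /=.
    by rewrite addn0.
  by rewrite /rose_src /= addn0 eqxx /= addn1 -addSnnS.
case: e => //; have := walk_rev rose_flipK fwd.
by rewrite -map_comp -map_rev.
Qed.

Lemma walk_flatten (D T : eqType) (v : D -> T) tau x (ss : seq (seq D)) :
  {in ss, forall s, walk v tau x s x} -> walk v tau x (flatten ss) x.
Proof.
elim: ss => //= s ss IH w; apply/walk_cat; exists x; first exact/w/mem_head.
by apply: IH => t tss; apply: w; rewrite inE tss orbT.
Qed.

Lemma rose_pairing : pairing rose_label rose_flip rose_src None rose_walk.
Proof.
split; first exact: uniq_rose_walk.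
  move=> [[q e] j]; rewrite !mem_rose_walk /= => /andP[qn jW].
  split; [by rewrite qn|exact: rose_flipK| |].
    by rewrite /rose_flip !xpair_eqE /= eqb_negLR eqxx; case: e.
  by rewrite /rose_label /=; case: e; rewrite ?linvK.
by apply: walk_flatten => _ /mapP[p _ ->]; apply: walk_segment.
Qed.

Lemma wval_rose : wval (map rose_label rose_walk) =
  \prod_(0 <= i < n) [~ wval (W (i, false)), wval (W (i, true))].
Proof.
have seg q e : \prod_(j <- segment_indices (q, e)) lval (rose_label (q, e, j)) =
    if e then wval (W q) else (wval (W q))^-1.
  rewrite -wval_inv /wval /segment_indices /rose_label /=; case: e.
    rewrite -[in RHS](mkseq_nth (1, true) (W q)) /mkseq big_map.
    exact: eq_bigr.
  rewrite -[in RHS](mkseq_nth (1, true) (W q)) /mkseq -map_comp.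
  by rewrite -map_rev big_map; apply: eq_bigr.
rewrite /wval big_map big_allpairs_dep big_allpairs_dep /index_iota subn0.
apply: eq_bigr => i _; rewrite !big_cons big_nil !seg /=.
by rewrite commgEl conjgE !gsimpl.
Qed.

(** Each of the [2 * n] loops has one edge more than inner vertices. For an empty word the
    predecessor is truncated, which only makes the inequality slacker. *)
Lemma size_rose_walk :
  (size rose_walk + 2 <= (based_vertex_count rose_src None rose_walk).*2 + 4 * n)%N.
Proof.
pose L : seq rose_vertex := None :: [seq Some (q, j) |
  q <- [seq (i, b) | i <- iota 0 n, b <- [:: false; true]],
  j <- iota 1 (size (W q)).-1].
have szL : (size rose_walk + 2 <= (size L).*2 + 4 * n)%N.
  have -> : size rose_walk =
      (\sum_(i <- iota 0 n) 2 * (size (W (i, false)) + size (W (i, true))))%N.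
    rewrite size_allpairs_dep sumnE big_map big_allpairs_dep.
    apply: eq_bigr => i _; rewrite !big_cons big_nil /segment_indices /=.
    by rewrite !size_rev !size_iota; lia.
  have -> : size L = (\sum_(i <- iota 0 n)
      ((size (W (i, false))).-1 + (size (W (i, true))).-1)).+1.
    rewrite /L -cat1s size_cat size_allpairs_dep sumnE big_map big_allpairs_dep.
    rewrite add1n; congr _.+1; apply: eq_bigr => i _.
    by rewrite !big_cons big_nil /= !size_iota addn0.
  have {3}-> : n = (\sum_(i <- iota 0 n) 1)%N by rewrite sum1_size size_iota.
  rewrite doubleS -muln2 big_distrl big_distrr /= addn2 !addSn !ltnS.
  rewrite -big_split /=; apply: leq_sum => i _.
  by case: (size _) => [|k]; case: (size _) => [|k']; lia.
apply: leq_trans szL _; rewrite leq_add2r leq_double; apply: uniq_leq_size.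
  rewrite /L cons_uniq; apply/andP; split.
    by apply/negP => /allpairsPdep[? [? []]].
  apply: allpairs_uniq_dep; last by move=> [p j] [p' j'] _ _ /= [-> ->].
    apply: allpairs_uniq_dep; rewrite ?iota_uniq //.
    by move=> [i a] [i' a'] _ _ /= [-> ->].
  by move=> q _; apply: iota_uniq.
move=> u; rewrite /L !inE mem_undup inE => /predU1P[->|]; first by rewrite eqxx.
case/allpairsPdep=> [q [j [qin jin ->]]]; apply/orP; right; apply/mapP.
have [j0 jW] : (0 < j)%N /\ (j < size (W q))%N.
  by move: jin; rewrite mem_iota; case: (size (W q)) => [|k] /=; case: (j).
exists (q, true, j).
  rewrite mem_rose_walk jW andbT.
  by case/allpairsPdep: qin => [i [b [iin _ ->]]]; move: iin; rewrite mem_iota.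
rewrite /rose_src /rose_point /= addn0.
by rewrite gtn_eqF // ltn_eqF.
Qed.

End CommutatorGraph.

(** A rose spelling the [k] commutators is folded until its walk is reduced; by uniqueness of
    reduced words the walk then spells [u] letter by letter. The inequality is Euler's formula for
    genus [k] and one face. *)
Lemma commutator_product_pairing (F : groupType) (B : set F) u k :
  free_basis B -> over_basis B u -> reduced u -> commutator_product k (wval u) ->
  exists (lab : rose_dart -> letter F) tau (v : rose_dart -> rose_vertex) x s,
    [/\ pairing lab tau v x s, map lab s = u &
      (size s + 2 <= (based_vertex_count v x s).*2 + 4 * k)%N].
Proof.
move=> B_free ou ru [t uE].
have word g := cid2 (basis_spans B_free g).
pose W (q : nat * bool) := s2val (word (let p := nth (1, 1) t q.1 in
  if q.2 then p.2 else p.1)).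
have WE q : wval (W q) = (let p := nth (1, 1) t q.1 in if q.2 then p.2 else p.1).
  by rewrite /W; case: (word _).
have oW q : over_basis B (W q) by rewrite /W; case: (word _).
have [tau [v [x [s [ps rs sub sE le]]]]] := fold_reduced (rose_pairing W k).
have sr := size_rose_walk W k.
exists (rose_label W), tau, v, x, s; split=> //; last first.
  move: le sr; rewrite -!muln2; move: (based_vertex_count _ _ _) => n1.
  by move: (based_vertex_count _ _ _) (size _) (size _); clear; lia.
apply: (wval_inj B_free) => //.
  move=> l /mapP[d /sub]; rewrite mem_rose_walk => /andP[_ dW] ->.
  have := oW d.1.1 _ (mem_nth (1, true) dW).
  by rewrite /rose_label; case: ifP.
rewrite sE wval_rose uE (big_nth (1, 1)) size_tuple.
by apply: eq_bigr => i _; rewrite !WE.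
Qed.

(** * Stable commutator length from linear bounds *)

Section StableBounds.
Variable G : groupType.
Implicit Types (g h : G) (N e n k m : nat).

(* Linear bounds that force [scl g = e / (2 * N)]. *)
Definition stable_bounds g N e := [/\ (0 < N)%N,
  exists C, forall m, commutator_product (m * e + C) (g ^+ (N * m.*2.+1)) &
  forall n k, commutator_product k (g ^+ n) -> (n * e <= 2 * N * k)%N].

Lemma stable_boundsJ g h N e : stable_bounds g N e -> stable_bounds (g ^ h) N e.
Proof.
move=> [N0 [C up] low]; split=> //.
  by exists C => m; rewrite -conjXg; apply: commutator_productJ.
move=> n k; rewrite -conjXg => /(commutator_productJ h^-1).
by rewrite conjgK; apply: low.
Qed.

Lemma stable_boundsX g N e j :
  stable_bounds g N e -> stable_bounds (g ^+ j) N (j * e).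
Proof.
move=> [N0 [C up] low]; split=> //.
  exists (j * C)%N => m; rewrite mulnCA -mulnDr expgnAC.
  exact: commutator_productX.
by move=> n k; rewrite -expgnA => /low; rewrite mulnA [(n * j)%N]mulnC.
Qed.

Lemma chain_bound_nseq g N e : chain_bound (nseq N g) e ->
  exists C, forall m, commutator_product (m * e + C) (g ^+ (N * m.*2.+1)).
Proof.
move=> [C b]; exists C => m; rewrite (mulnC N) expgnA; have := b m.
suff -> : \prod_(h <- nseq N g) h ^+ m.*2.+1 = g ^+ m.*2.+1 ^+ N by [].
by elim: N {b} => [|N IH]; rewrite ?big_nil //= big_cons IH (expgS (g ^+ _)).
Qed.

(** The exponents [N * m.*2.+1] are [2 * N] apart, and the gap is filled with fewer than [2 * N]
    copies of [g], at bounded cost. *)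
Lemma cl_le_linear g N e : commutator_subgroup g -> stable_bounds g N e ->
  exists C, forall n, (2 * N * cl (g ^+ n) <= n * e + C)%N.
Proof.
move=> /commutator_product_cl cg [N0 [C up] _].
exists (2 * N * (C + 2 * N * cl g))%N => n.
have [nN|Nn] := ltnP n N.
  have /cl_le := commutator_productX n cg.
  move: (cl (g ^+ n)) (cl g) => a b le.
  apply: leq_trans (leq_addl _ _); rewrite leq_mul2l; apply/orP; right.
  by apply: leq_trans le _; apply: leq_trans (leq_addl _ _); rewrite leq_mul2r; lia.
set m := ((n - N) %/ (2 * N))%N; set r := ((n - N) %% (2 * N))%N.
have nE : n = (N * m.*2.+1 + r)%N.
  by have := divn_eq (n - N) (2 * N); rewrite -/m -/r -muln2; nia.
have rN : (r < 2 * N)%N by rewrite ltn_mod muln_gt0.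
rewrite {1}nE expgnDr.
have /cl_le le := commutator_productM (up m) (commutator_productX r cg).
apply: leq_trans (leq_mul (leqnn (2 * N)%N) le) _.
rewrite !mulnDr !addnA leq_add //.
  rewrite leq_add2r nE -muln2; nia.
by rewrite leq_mul2l orbC leq_mul2r (ltnW rN) orbT.
Qed.

Lemma scl_stable_bounds (R : realType) g N e :
  commutator_subgroup g -> stable_bounds g N e ->
  scl R g = (e%:R / (2 * N)%:R)%R.
Proof.
move=> cg sb; have [C up] := cl_le_linear cg sb.
have [N0 _ low] := sb.
have twoN0 : (0 < (2 * N)%:R :> R)%R by rewrite ltr0n muln_gt0.
apply: cvg_lim; first exact: Rhausdorff.
(* The shift discards the term at [0], where the quotient is a default value. *)
rewrite -cvg_shiftS.
apply: (@squeeze_cvgr _ _ _ _ (fun=> e%:R / (2 * N)%:R)%R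
  (fun n => e%:R / (2 * N)%:R + C%:R * n.+1%:R^-1)%R).
- near=> n; have n0 : (0 < n.+1%:R :> R)%R by rewrite ltr0n.
  have cgn : commutator_product (cl (g ^+ n.+1)) (g ^+ n.+1).
    apply: commutator_product_cl; apply/commutator_subgroupP.
    by exists (n.+1 * cl g)%N; apply/commutator_productX/commutator_product_cl.
  rewrite ler_pdivrMr // mulrAC ler_pdivlMr // -!natrM ler_nat.
  apply/andP; split.
    by rewrite mulnC [X in (_ <= X)%N]mulnC; apply: low.
  have := up n.+1; rewrite -(ler_nat R) natrD !(natrM R (2 * N)) (natrM R n.+1) /=.
  have a1 : (1 <= (2 * N)%:R :> R)%R by rewrite ler1n muln_gt0.
  move: (n.+1%:R : R)%R ((2 * N)%:R : R)%R n0 twoN0 a1 => b a b0 a0 a1.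
  move: (cl _)%:R%R (e%:R)%R (ler0n R C) => c r; move: (C%:R)%R => d d0 le.
  rewrite -subr_ge0.
  have -> : (r / a + d / b - c / b = (r * b + d * a - c * a) / (a * b))%R.
    by field; rewrite !gt_eqF.
  rewrite divr_ge0 ?mulr_ge0 ?(ltW a0) ?(ltW b0) //.
  have : (0 <= d * (a - 1))%R by rewrite mulr_ge0 // subr_ge0.
  by lra.
- exact: cvg_cst.
- rewrite -[X in (_ --> X)%classic]addr0; apply: cvgD; first exact: cvg_cst.
  rewrite -[X in (_ --> X)%classic](mulr0 (C%:R : R)%R); apply: cvgMr; exact: cvg_harmonic.
Unshelve. all: by end_near.
Qed.

End StableBounds.

(** * Monoids of natural vectors *)

Section Dickson.
Variable K : finType.
Implicit Types (x y h : {ffun K -> nat}) (f : nat -> {ffun K -> nat}).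

Definition vec_le x y := [forall k, x k <= y k]%N.
Definition vec_sub x y := [ffun k => x k - y k]%N.
Definition vec0 : {ffun K -> nat} := [ffun => 0%N].

(** [p n] is an index at which [u] is minimal on $[n, \infty)$; each new index is such a minimum
    beyond the previous one. *)
Lemma nondecreasing_subseq (u : nat -> nat) : exists phi : nat -> nat,
  (forall i, phi i < phi i.+1)%N /\ (forall i, u (phi i) <= u (phi i.+1))%N.
Proof.
have /choice[p pP] n : exists m, (n <= m)%N /\ forall j, (n <= j)%N -> (u m <= u j)%N.
  have ex : exists c, `[< exists2 m, (n <= m)%N & u m = c >].
    by exists (u n); apply/asboolP; exists n.
  case: (ex_minnP ex) => c /asboolP[m nm <-] cmin; exists m; split=> // j nj.
  by apply: cmin; apply/asboolP; exists j.
exists (fun i => iter i (fun j => p j.+1) (p 0%N)); split=> i; rewrite iterS.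
  by have [] := pP (iter i (fun j => p j.+1) (p 0%N)).+1.
have [le _] := pP (iter i (fun j => p j.+1) (p 0%N)).+1.
case: i le => [|i] le; first by have [_] := pP 0%N; apply.
rewrite {1}iterS.
have [le1 min1] := pP (iter i (fun j => p j.+1) (p 0%N)).+1; apply: min1.
by apply: leq_trans (ltnW le); rewrite iterS.
Qed.

Lemma strictly_increasing (phi : nat -> nat) :
  (forall i, phi i < phi i.+1)%N -> forall i j, (i < j)%N -> (phi i < phi j)%N.
Proof.
by move=> inc i; elim=> // j IH; rewrite ltnS leq_eqVlt => /predU1P[->|/IH/ltn_trans]; [|apply].
Qed.

Lemma dickson_subseq f (ks : seq K) : exists phi : nat -> nat,
  (forall i, phi i < phi i.+1)%N /\
  {in ks, forall k i, f (phi i) k <= f (phi i.+1) k}%N.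
Proof.
elim: ks => [|k ks [phi [inc mono]]]; first by exists id.
have [psi [inc' mono']] := nondecreasing_subseq (fun i => f (phi i) k).
exists (phi \o psi); split=> [i|k' + i] /=; first exact: strictly_increasing.
rewrite inE => /predU1P[->//|ks'].
have : (psi i <= psi i.+1)%N by apply: ltnW.
elim: (psi i.+1) => [|n IH]; first by rewrite leqn0 => /eqP->.
rewrite leq_eqVlt => /predU1P[-> //|]; rewrite ltnS => /IH le.
by apply: leq_trans le _; apply: mono.
Qed.

Lemma dickson f : exists i j, (i < j)%N /\ vec_le (f i) (f j).
Proof.
have [phi [inc mono]] := dickson_subseq f (enum K).
exists (phi 0%N), (phi 1%N); split=> //; apply/forallP => k.
by apply: mono; rewrite mem_enum.
Qed.

(** Otherwise elements above none of the earlier ones could be picked forever, against [dickson]. *)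
Lemma dickson_basis (Q : {ffun K -> nat} -> Prop) : exists Hs : seq {ffun K -> nat},
  (forall h, h \in Hs -> Q h) /\ forall x, Q x -> exists2 h, h \in Hs & vec_le h x.
Proof.
apply: contrapT => nobasis.
have /choice[g gP] (Hs : seq {ffun K -> nat}) : exists x,
    (forall h, h \in Hs -> Q h) -> Q x /\ forall h, h \in Hs -> ~~ vec_le h x.
  have [QHs|nQ] := pselect (forall h, h \in Hs -> Q h); last by exists vec0.
  apply: contrapT => nx; apply: nobasis; exists Hs; split=> // x Qx.
  apply: contrapT => nh; apply: nx; exists x => _; split=> // h hHs.
  by apply/negP => le; apply: nh; exists h.
pose L := fix L n := if n is n'.+1 then g (L n') :: L n' else [::].
have QL n : forall h, h \in L n -> Q h.
  elim: n => //= n IH h; rewrite inE => /predU1P[->|/IH//].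
  by have [] := gP _ IH.
have memL i j : (i < j)%N -> g (L i) \in L j.
  elim: j => // j IH; rewrite ltnS leq_eqVlt inE => /predU1P[->|/IH->].
    by rewrite eqxx.
  by rewrite orbT.
have [i [j [ij le]]] := dickson (fun n => g (L n)).
by have [_ /(_ _ (memL _ _ ij))] := gP _ (QL j); rewrite le.
Qed.

Variable P : {ffun K -> nat} -> Prop.
Hypothesis P_sub : forall x y, P x -> P y -> vec_le y x -> P (vec_sub x y).

(** Subtracting a minimal nonzero element below [x] stays in [P] and lowers the sum of the
    entries. *)
Lemma hilbert_basis : exists Hs : seq {ffun K -> nat},
  (forall h, h \in Hs -> P h /\ h != vec0) /\
  forall x, P x -> exists c : {ffun 'I_(size Hs) -> nat},
    forall k, x k = (\sum_i c i * nth vec0 Hs i k)%N.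
Proof.
have [Hs [QHs basis]] := dickson_basis (fun x => P x /\ x != vec0).
exists Hs; split=> // x; have [n] := ubnP (\sum_k x k)%N.
elim: n x => // n IH x; rewrite ltnS => le_n Px.
have [->|x0] := eqVneq x vec0.
  by exists [ffun => 0%N] => k; rewrite ffunE big1 // => i _; rewrite ffunE.
have [h hHs hx] := basis x (conj Px x0); have [Ph h0] := QHs h hHs.
have [||c cE] := IH (vec_sub x h); last first.
- have hI : (index h Hs < size Hs)%N by rewrite index_mem.
  exists [ffun i => (c i + (i == Ordinal hI))%N] => k.
  have -> : x k = (vec_sub x h k + h k)%N.
    by rewrite ffunE subnK //; apply: (forallP hx).
  rewrite cE; under [RHS]eq_bigr do rewrite ffunE mulnDl.
  rewrite big_split /= [X in (_ = _ + X)%N](bigD1 (Ordinal hI)) //= eqxx mul1n.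
  rewrite nth_index // [X in (_ = _ + (_ + X))%N]big1 ?addn0 //.
  by move=> i /negPf->; rewrite mul0n.
- exact: P_sub.
apply: leq_trans le_n; have [k hk] : exists k, (0 < h k)%N.
  apply: contrapT => nk; case/eqP: h0; apply/ffunP => k; rewrite ffunE.
  by apply/eqP; rewrite -leqn0 leqNgt; apply/negP => hk; apply: nk; exists k.
rewrite (bigD1 k) //= [X in (_ < X)%N](bigD1 k) //= -addSn leq_add //.
  by rewrite ffunE ltn_subrL hk (leq_trans hk) //; apply: (forallP hx).
by apply: leq_sum => j _; rewrite ffunE leq_subr.
Qed.

(* The supremum of a ratio of linear forms over [P] is attained: by the
   mediant inequality it suffices to look at the Hilbert basis. *)
Lemma best_ratio (a b : K -> nat) x0 : (forall k, 0 < b k)%N -> P x0 -> x0 != vec0 ->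
  exists y, [/\ P y, y != vec0 & forall x, P x ->
    ((\sum_k x k * a k) * (\sum_k y k * b k) <= (\sum_k y k * a k) * (\sum_k x k * b k))%N].
Proof.
move=> b0 Px0 x00; have [Hs [PHs gen]] := hilbert_basis.
pose A x := (\sum_k x k * a k)%N; pose C x := (\sum_k x k * b k)%N.
have C0 x : x != vec0 -> (0 < C x)%N.
  apply: contraNT; rewrite -leqNgt leqn0 sum_nat_eq0 => /forallP z.
  apply/eqP/ffunP => k; rewrite ffunE; have := z k.
  by rewrite muln_eq0 (gtn_eqF (b0 k)) orbF => /eqP.
have [y yHs ymax] : exists2 y, y \in Hs & forall h, h \in Hs -> (A h * C y <= A y * C h)%N.
  have : Hs != [::].
    apply: contraNneq x00 => Hs0; have [c cE] := gen _ Px0.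
    apply/eqP/ffunP => k; rewrite cE ffunE big1 // => i _.
    by have := ltn_ord i; rewrite [X in (_ < size X)%N]Hs0.
  have posHs h : h \in Hs -> (0 < C h)%N by case/PHs => _ /C0.
  elim: (Hs) posHs => // h hs IH pos _.
  have [hs0|hs0] := eqVneq hs [::].
    by exists h; rewrite ?mem_head // hs0 => h'; rewrite inE => /eqP->.
  have [|y yhs ymax] := IH _ hs0.
    by move=> h' h's; apply: pos; rewrite inE h's orbT.
  have [le|lt] := leqP (A h * C y) (A y * C h).
    exists y; first by rewrite inE yhs orbT.
    by move=> h'; rewrite inE => /predU1P[->|/ymax].
  exists h; first exact: mem_head.
  move=> h'; rewrite inE => /predU1P[->//|h's].
  have := ymax _ h's; have := pos y _; rewrite inE yhs orbT => /(_ isT) Cy.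
  move=> le1; rewrite -(leq_pmul2r Cy); nia.
have [Py y0] := PHs _ yHs; exists y; split=> // x Px; have [c cE] := gen _ Px.
have lin (d : K -> nat) : (\sum_k x k * d k = \sum_i c i * (\sum_k nth vec0 Hs i k * d k))%N.
  under eq_bigr do rewrite cE big_distrl /=.
  rewrite exchange_big /=; apply: eq_bigr => i _; rewrite big_distrr /=.
  by apply: eq_bigr => k _; rewrite mulnA.
rewrite !lin big_distrl big_distrr /=; apply: leq_sum => i _.
rewrite -mulnA [X in (_ <= X)%N]mulnCA leq_mul2l; apply/orP; right.
exact: ymax (mem_nth _ (ltn_ord i)).
Qed.

End Dickson.

(** * Flows of transitions *)

Section Flows.
Variables (F : groupType) (w : seq (letter F)).
Local Notation L := (size w).

Definition cletter (a : 'I_L) : letter F := nth (1, true) w a.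

(* Corner [a] of the cyclic word [w] precedes its letter [a]. At a vertex of a
   surface, the corner [a] is followed by the corner [b] when the letter [a] is
   paired with the letter that precedes [b]; the corners are then preceded and
   followed, at the other end of that edge, by [ord_pred b] and [ordS a]. *)
Definition transition : finType := ('I_L * 'I_L)%type.
Definition allowed (t : transition) := cletter (ord_pred t.2) == linv (cletter t.1).
Definition other_end (t : transition) : transition := (ord_pred t.2, ordS t.1).

(** The balance at each corner is what lets the transitions close up to cycles around a vertex. *)
Definition vertex_flow (x : {ffun transition -> nat}) :=
  (forall t, ~~ allowed t -> x t = 0%N) /\
  forall a, (\sum_b x (a, b) = \sum_b x (b, a))%N.

Lemma vertex_flow_sub x y : vertex_flow x -> vertex_flow y -> vec_le y x ->
  vertex_flow (vec_sub x y).
Proof.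
move=> [x0 xb] [y0 yb] /forallP le; split=> [t nt|a].
  by rewrite ffunE x0 ?sub0n.
under eq_bigr do rewrite ffunE; under [RHS]eq_bigr do rewrite ffunE.
by rewrite !sumnB ?xb ?yb.
Qed.

Variable Hs : seq {ffun transition -> nat}.
Local Notation h i := (nth (vec0 transition) Hs i).

Definition total_flow (y : {ffun 'I_(size Hs) -> nat}) (t : transition) :=
  (\sum_i y i * h i t)%N.

(** An edge shows a transition at each of its two ends, so both must occur equally often over all
    vertices together. *)
Definition closed_up y := forall t, total_flow y (other_end t) = total_flow y t.

Lemma closed_up_sub y z : closed_up y -> closed_up z -> vec_le z y ->
  closed_up (vec_sub y z).
Proof.
move=> cy cz /forallP le t; have := cy t; have := cz t; rewrite /total_flow.
under [in X in _ -> _ -> X]eq_bigr do rewrite ffunE mulnBl.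
under [in X in _ -> _ -> _ = X]eq_bigr do rewrite ffunE mulnBl.
by rewrite !sumnB => [-> ->|i _|i _] //; rewrite leq_mul2r le orbT.
Qed.


Lemma nth_flatten_nseq (T : Type) (x0 : T) (u : seq T) N i :
  (i < N * size u)%N -> nth x0 (flatten (nseq N u)) i = nth x0 u (i %% size u).
Proof.
elim: N i => [|N IH] i; first by rewrite ltn0.
rewrite mulSn /= nth_cat => iN; case: ltnP => [iu|ui]; first by rewrite modn_small.
rewrite IH; last by rewrite ltn_subLR.
by rewrite -[in RHS](subnK ui) modnDr.
Qed.

Lemma size_flatten_nseq (T : Type) (u : seq T) N :
  size (flatten (nseq N u)) = (N * size u)%N.
Proof. by elim: N => //= N IH; rewrite size_cat IH mulSn. Qed.

Lemma walk_nth (D T : eqType) (v : D -> T) tau d0 (x : T) (s : seq D) (y : T) :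
  walk v tau x s y ->
  forall i, (i < size s)%N -> v (nth d0 s i) = (if i is i'.+1 then
     v (tau (nth d0 s i')) else x) /\
  (i.+1 = size s -> v (tau (nth d0 s i)) = y).
Proof.
elim: s x => //= d s IH x /andP[/eqP vd w'] [|i] /=.
  move=> _; split=> // - [s0]; move: w'; case: (s) s0 => //= _; exact/eqP.
rewrite ltnS => /(IH _ w')[vi last_i]; split; first by case: (i) vi.
by move=> [/last_i].
Qed.

Hypothesis gen : forall x, vertex_flow x ->
  exists c : {ffun 'I_(size Hs) -> nat}, forall t, x t = (\sum_i c i * h i t)%N.

Lemma sum_count (D : Type) (I : finType) (Q : pred D) (f : D -> I) s :
  (\sum_i count (fun d => Q d && (f d == i)) s = count Q s)%N.
Proof.
elim: s => [|d s IH] /=; first by rewrite big1.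
rewrite big_split /= IH; congr (_ + _)%N; case: (Q d) => /=; last by rewrite big1.
by rewrite (bigD1 (f d)) //= eqxx big1 // => i /negPf; rewrite eq_sym => ->.
Qed.

Lemma sum_count_seq (D T : eqType) (Q : pred D) (f : D -> T) s U :
  uniq U -> {in s, forall d, f d \in U} ->
  (\sum_(u <- U) count (fun d => (f d == u) && Q d) s = count Q s)%N.
Proof.
move=> uU; elim: s => [|d s IH] sub /=; first by rewrite big1.
rewrite big_split /= IH => [|d' d's]; last by apply: sub; rewrite inE d's orbT.
congr (_ + _)%N; rewrite (bigD1_seq (f d)) ?sub ?mem_head //= eqxx.
by rewrite big1 ?addn0 // => u /negPf; rewrite eq_sym => ->.
Qed.

(** [rho] is the next dart along the closed walk, and [p] the position of a dart in its copy of
    [w]. *)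
Lemma pairing_rotation (D T : eqType) (lab : D -> letter F) tau (v : D -> T) x s N :
  (0 < N)%N -> (0 < L)%N -> pairing lab tau v x s ->
  map lab s = flatten (nseq N w) ->
  exists (rho : D -> D) (p : D -> 'I_L),
    [/\ {in s, forall d, rho d \in s}, {in s &, injective rho},
        {in s, forall d, p (rho d) = ordS (p d)},
        {in s, forall d, lab d = cletter (p d)} &
        {in s, forall d, v (rho d) = v (tau d)}].
Proof.
move=> N0 L0 [us Htau wk] labs.
have szs : size s = (N * L)%N by rewrite -(size_map lab) labs size_flatten_nseq.
have s0 : (0 < size s)%N by rewrite szs muln_gt0 N0.
pose rho d := nth d s ((index d s).+1 %% size s).
have p_lt d : (index d s %% L < L)%N by rewrite ltn_mod.
pose p d := Ordinal (p_lt d).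
have idx_lt i : (i %% size s < size s)%N by rewrite ltn_mod.
have rho_s d : rho d \in s by apply: mem_nth.
have idx_rho d : index (rho d) s = (index d s).+1 %% size s by rewrite index_uniq.
have p_rho d : d \in s -> p (rho d) = ordS (p d).
  move=> ds; apply: val_inj; rewrite /= idx_rho szs modn_dvdm ?dvdn_mull //.
  by rewrite -addn1 -modnDml addn1.
have rho_inj : {in s &, injective rho}.
  move=> d d' ds ds' /(congr1 (index^~ s)); rewrite !idx_rho => e.
  rewrite -(nth_index d ds) -(nth_index d ds'); congr nth.
  move: e ds ds'; rewrite -!index_mem.
  move: (index d s) (index d' s) => i j e ilt jlt.
  rewrite -(modn_small ilt) -(modn_small jlt).
  by apply/eqP; rewrite -(eqn_modDr 1) !addn1; apply/eqP.
have lab_p d : d \in s -> lab d = cletter (p d).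
  move=> ds; rewrite /cletter /= -(nth_flatten_nseq _ (N := N)) -?szs ?index_mem //.
  by rewrite -labs (nth_map d) ?index_mem // nth_index.
have v_rho d : d \in s -> v (rho d) = v (tau d).
  move=> ds; have di : (index d s < size s)%N by rewrite index_mem.
  rewrite /rho; have [lt|] := ltnP (index d s).+1 (size s).
    by rewrite modn_small //; have [-> _] := walk_nth d wk lt; rewrite nth_index.
  rewrite leq_eqVlt ltnNge di orbF => /eqP e; rewrite -e modnn.
  have [_ /(_ (esym e))] := walk_nth d wk di; rewrite nth_index // => ->.
  by have [-> _] := walk_nth d wk s0.
by exists rho, p; split=> // d _.
Qed.

Lemma perm_in_map (D : eqType) (f : D -> D) s : uniq s ->
  {in s, forall d, f d \in s} -> {in s &, injective f} -> perm_eq (map f s) s.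
Proof.
move=> us fs finj; have u : uniq (map f s) by rewrite map_inj_in_uniq.
have [|_ e] := uniq_min_size u _ (eq_leq (esym (size_map f s))).
  by move=> d /mapP[d' /fs ds ->].
exact: uniq_perm.
Qed.

Lemma perm_tau (D T : eqType) (lab : D -> letter F) tau (v : D -> T) x s :
  pairing lab tau v x s -> perm_eq (map tau s) s.
Proof.
move=> [us Htau _]; apply: perm_in_map => // [d /Htau[]//|d d' ds ds' e].
have [_ <- _ _] := Htau d ds; have [_ <- _ _] := Htau d' ds'.
by rewrite e.
Qed.

(** [sigma] permutes the darts at each vertex, so their transitions form a nonzero vertex flow, a
    sum of at least one basis element; hence the bound on vertices. [tau] turns a transition into
    its other end. *)
Lemma flow_of_pairing (D T : eqType) (lab : D -> letter F) tau (v : D -> T) x s N :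
  (0 < N)%N -> (0 < L)%N -> pairing lab tau v x s ->
  map lab s = flatten (nseq N w) ->
  exists y, [/\ closed_up y, (based_vertex_count v x s <= \sum_i y i)%N &
    (\sum_t total_flow y t = N * L)%N].
Proof.
move=> N0 L0 ps labs; have [rho [p [rho_s rho_inj p_rho lab_p v_rho]]] :=
  pairing_rotation N0 L0 ps labs.
have perm_tau := perm_tau ps; have [us Htau wk] := ps.
have szs : size s = (N * L)%N by rewrite -(size_map lab) labs size_flatten_nseq.
have s0 : (0 < size s)%N by rewrite szs muln_gt0 N0.
pose sigma d := rho (tau d).
have tau_s d : d \in s -> tau d \in s by case/Htau.
have tauK d : d \in s -> tau (tau d) = d by case/Htau.
have perm_sigma : perm_eq (map sigma s) s.
  apply: perm_in_map => // [d ds|d d' ds ds' /rho_inj e].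
    exact/rho_s/tau_s.
  by rewrite -(tauK d) // e ?tauK ?tau_s.
have v_sigma d : d \in s -> v (sigma d) = v d.
  by move=> ds; rewrite /sigma v_rho ?tauK ?tau_s.
pose flow u : {ffun transition -> nat} :=
  [ffun t => count (fun d => [&& v d == u, p d == t.1 & p (sigma d) == t.2]) s].
have flowP u : vertex_flow (flow u).
  split=> [t|a].
    apply: contraNeq; rewrite ffunE -lt0n -has_count => /hasP[d ds /and3P[_ /eqP pd /eqP pd']].
    rewrite /allowed -pd -pd' /sigma p_rho ?tau_s // ordSK -!lab_p ?tau_s //.
    by have [_ _ _ ->] := Htau d ds.
  under eq_bigr do rewrite ffunE; under [RHS]eq_bigr do rewrite ffunE.
  transitivity (count (fun d => (v d == u) && (p d == a)) s).
    rewrite -(sum_count _ (fun d => p (sigma d))); apply: eq_bigr => b _.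
    by apply: eq_count => d /=; rewrite andbA.
  transitivity (count (fun d => (v d == u) && (p (sigma d) == a)) s).
    rewrite -(seq.permP perm_sigma) count_map; apply: eq_in_count => d ds /=.
    by rewrite v_sigma.
  rewrite -(sum_count _ p); apply: eq_bigr => b _.
  by apply: eq_count => d /=; rewrite -andbA [in RHS](andbC (p d == b)).
have /choice[c cE] u := gen (flowP u).
pose U := undup (map v s).
pose y : {ffun 'I_(size Hs) -> nat} := [ffun i => \sum_(u <- U) c u i].
have yE t : total_flow y t =
    count (fun d => (p d == t.1) && (p (sigma d) == t.2)) s.
  rewrite /total_flow; under eq_bigr do rewrite ffunE big_distrl /=.
  rewrite exchange_big /=; under eq_bigr do rewrite -cE ffunE.
  apply: sum_count_seq; first exact: undup_uniq.
  by move=> d ds; rewrite mem_undup map_f.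
exists y; split.
- move=> t; rewrite !yE -(seq.permP perm_tau) count_map; apply: eq_in_count => d ds /=.
  rewrite /sigma tauK // !p_rho ?tau_s // (inj_eq (@ordS_inj _)) andbC.
  by rewrite [in RHS](can2_eq (@ordSK _) (@ord_predK _)).
- have -> : based_vertex_count v x s = size U.
    rewrite /based_vertex_count /U; case: (s) wk s0 => //= d s' /andP[/eqP-> _] _.
    by rewrite mem_head.
  under eq_bigr do rewrite ffunE.
  rewrite exchange_big /= -sum1_size big_seq [X in (_ <= X)%N]big_seq.
  apply: leq_sum => u; rewrite mem_undup => /mapP[d ds ud].
  rewrite lt0n; apply/negP; rewrite sum_nat_eq0 => /forallP c0.
  have := cE u (p d, p (sigma d)); rewrite big1 => [|i _].
    apply/eqP; rewrite ffunE /= -lt0n -has_count; apply/hasP; exists d => //.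
    by rewrite -ud !eqxx.
  by have /eqP-> := c0 i; rewrite mul0n.
- under eq_bigr do rewrite yE.
  have -> : (N * L)%N = count predT s by rewrite count_predT.
  rewrite -(sum_count _ (fun d => (p d, p (sigma d)))).
  by apply: eq_bigr => -[a b] _.
Qed.

End Flows.

Lemma chain_bound_powers (G : groupType) (g : G) (qs : seq nat) e :
  chain_bound [seq g ^+ q | q <- qs] e ->
  exists C, forall m, commutator_product (m * e + C) (g ^+ (sumn qs * m.*2.+1)).
Proof.
move=> [C b]; exists C => m; have := b m.
suff -> : \prod_(h <- [seq g ^+ q | q <- qs]) h ^+ m.*2.+1 =
  g ^+ (sumn qs * m.*2.+1) by [].
elim: qs {b} => [|q qs IH] /=; first by rewrite big_nil.
by rewrite big_cons IH mulnDl expgnDr expgnA.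
Qed.

Lemma perm_reindex (X : eqType) n (f g : 'I_n -> X) :
  perm_eq [seq g i | i <- enum 'I_n] [seq f i | i <- enum 'I_n] ->
  exists s : {perm 'I_n}, forall i, f (s i) = g i.
Proof.
rewrite -[X in perm_eq _ X](_ : tval [tuple f i | i < n] = _); last first.
  by rewrite -val_ord_tuple.
move=> /tuple_permP[s sE]; exists s => i.
have := congr1 (fun t => nth (g i) t i) sE.
rewrite (nth_map i) ?size_enum_ord // nth_ord_enum => ->.
by rewrite -tnth_nth !tnth_mktuple.
Qed.

Lemma uniq_flatten_map (X Y : eqType) (f : X -> seq Y) r : uniq r ->
  {in r, forall x, uniq (f x)} ->
  {in r &, forall x x' y, y \in f x -> y \in f x' -> x = x'} ->
  uniq (flatten (map f r)).
Proof.
elim: r => //= x r IH /andP[xr ur] uf disj.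
rewrite cat_uniq uf ?mem_head //= IH // ?andbT; first last.
- by move=> x1 x2 x1r x2r; apply: disj; rewrite inE ?x1r ?x2r orbT.
- by move=> x1 x1r; apply: uf; rewrite inE x1r orbT.
apply/hasPn => y /flatten_mapP[x' x'r yx']; apply: contra xr => yx.
by rewrite (disj x x' _ _ y) // ?mem_head // inE x'r orbT.
Qed.

Lemma flatten_orbits (D : finType) (rho : D -> D) : injective rho ->
  perm_eq (flatten [seq orbit rho x | x <- enum (froots rho)]) (enum D).
Proof.
move=> inj; have sym := fconnect_sym inj; apply: uniq_perm; rewrite ?enum_uniq //.
  apply: uniq_flatten_map; first exact: enum_uniq.
    by move=> x _; apply: orbit_uniq.
  move=> x x'; rewrite !mem_enum => /eqP xr /eqP x'r y.
  rewrite -!fconnect_orbit => /(fingraph.rootP sym) xy /(fingraph.rootP sym) x'y.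
  by rewrite -xr -x'r xy x'y.
move=> y; rewrite mem_enum; apply/flatten_mapP; exists (froot rho y).
  by rewrite mem_enum; apply: roots_root sym _.
by rewrite -fconnect_orbit sym; apply: connect_root.
Qed.

(** * From closed up flows back to surfaces *)

Section CyclicWord.
Variables (F : groupType) (w : seq (letter F)).
Local Notation L := (size w).

Definition prefix_val (a : nat) := wval (take a w).

Lemma prefix_valS (a : 'I_L) : prefix_val a * lval (cletter a) = prefix_val a.+1.
Proof.
rewrite /prefix_val (take_nth (1, true)) ?ltn_ord // -cats1 wval_cat.
by congr (_ * _); rewrite /wval big_seq1.
Qed.

(** [q] counts the passages through the end of [w]. When the reading returns to [a], it spells a
    conjugate of $w^q$ by the prefix before [a]. *)
Lemma wval_cyclic_walk (a : 'I_L) n : exists q,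
  (a + n = q * L + iter n (@ordS L) a)%N /\
  \prod_(0 <= j < n) lval (cletter (iter j (@ordS L) a)) =
    (prefix_val a)^-1 * wval w ^+ q * prefix_val (iter n (@ordS L) a).
Proof.
elim: n => [|n [q [qE IH]]].
  by exists 0%N; rewrite addn0 big_geq // mulg1 mulVg.
set b := iter n _ a in qE IH *; rewrite big_nat_recr //= -/b IH -!mulgA prefix_valS.
have [bL|] := ltnP b.+1 L.
  have bE : (b.+1 %% L = b.+1)%N by rewrite modn_small.
  by exists q; rewrite bE addnS qE addnS mulgA.
rewrite leq_eqVlt ltnNge ltn_ord orbF => /eqP bL.
have bE : (b.+1 %% L = 0)%N by rewrite -bL modnn.
exists q.+1; rewrite bE addnS qE mulSn -addnS -bL addn0 addnC; split=> //.
rewrite /prefix_val take_size take0.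
by rewrite [wval [::]]big_nil mulg1 expgSr mulgA.
Qed.

End CyclicWord.

Section FlowSurface.
Variables (F : groupType) (w : seq (letter F)).
Local Notation L := (size w).
Local Notation transition := (transition w).
Variable Hs : seq {ffun transition -> nat}.
Local Notation h i := (nth (vec0 transition) Hs (i : 'I_(size Hs))).
Hypothesis HsP : forall x, x \in Hs -> vertex_flow x /\ x != vec0 transition.
Hypothesis noloop : forall a, ~~ allowed ((a, a) : transition).
Variable y : {ffun 'I_(size Hs) -> nat}.
Hypothesis y_closed : closed_up y.

Let vertex : eqType := ('I_(size Hs) * nat)%type.
Let vertices : seq vertex := [seq (i, r) | i <- enum 'I_(size Hs), r <- iota 0 (y i)].
Let half_edges : seq (vertex * transition) :=
  [seq (u, t) | u <- vertices,
     t <- flatten [seq nseq (h u.1 t) t | t <- enum {: transition}]].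

Lemma sum_half_edges (f : vertex * transition -> nat) :
  (\sum_(z <- half_edges) f z = \sum_(u <- vertices) \sum_t h u.1 t * f (u, t))%N.
Proof.
rewrite big_allpairs_dep; apply: eq_bigr => u _.
rewrite big_flatten big_map big_enum /=; apply: eq_bigr => t _.
by rewrite big_nseq iter_addn_0 mulnC.
Qed.

Lemma sum_vertices (f : 'I_(size Hs) -> nat) :
  (\sum_(u <- vertices) f u.1 = \sum_i y i * f i)%N.
Proof.
rewrite big_allpairs_dep big_enum; apply: eq_bigr => i _ /=.
by rewrite big_const_seq count_predT size_iota iter_addn_0 mulnC.
Qed.

Lemma size_vertices : size vertices = (\sum_i y i)%N.
Proof.
rewrite -sum1_size (sum_vertices (fun=> 1%N)).
by apply: eq_bigr => i _; rewrite muln1.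
Qed.

Lemma size_half_edges : size half_edges = (\sum_t total_flow y t)%N.
Proof.
rewrite -sum1_size sum_half_edges (sum_vertices (fun i => \sum_t h i t * 1)%N).
rewrite exchange_big /=; apply: eq_bigr => i _; rewrite big_distrr /=.
by apply: eq_bigr => t _; rewrite muln1.
Qed.

Lemma count_half_edges (Q : pred (vertex * transition)) :
  count Q half_edges = (\sum_(u <- vertices) \sum_t h u.1 t * Q (u, t))%N.
Proof.
rewrite -(sum_half_edges (fun z => nat_of_bool (Q z))) -sum1_count big_mkcond.
by apply: eq_bigr => z _; case: (Q z).
Qed.

Lemma HsN (i : 'I_(size Hs)) : vertex_flow (h i) /\ h i != vec0 transition.
Proof. exact/HsP/mem_nth. Qed.

Lemma uniq_vertices : uniq vertices.
Proof.
apply: allpairs_uniq_dep; first exact: enum_uniq.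
  by move=> i _; apply: iota_uniq.
by move=> [i r] [i' r'] _ _ /= [-> ->].
Qed.

Lemma perm_count (X : eqType) (r r' : seq X) :
  (forall x, count_mem x r = count_mem x r') -> perm_eq r r'.
Proof. by move=> e; apply/allP => x _; rewrite /= e. Qed.

Lemma sum_snd (x : {ffun transition -> nat}) a :
  (\sum_t x t * (true && (t.2 == a)) = \sum_b x (b, a))%N.
Proof.
transitivity (\sum_b \sum_c x (b, c) * (true && (c == a)))%N.
  by rewrite pair_bigA; apply: eq_bigr => -[].
apply: eq_bigr => b _; rewrite (bigD1 a) //= eqxx muln1 big1 ?addn0 // => c.
by move=> /negPf->; rewrite muln0.
Qed.

Lemma sum_fst (x : {ffun transition -> nat}) a :
  (\sum_t x t * (true && (t.1 == a)) = \sum_b x (a, b))%N.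
Proof.
transitivity (\sum_b \sum_c x (b, c) * (true && (b == a)))%N.
  by rewrite pair_bigA; apply: eq_bigr => -[].
rewrite exchange_big /=.
apply: eq_bigr => b _; rewrite (bigD1 a) //= eqxx muln1 big1 ?addn0 // => c.
by move=> /negPf->; rewrite muln0.
Qed.

Lemma sum_pick (x : {ffun transition -> nat}) t0 :
  (\sum_t x t * (t == t0) = x t0)%N.
Proof.
rewrite (bigD1 t0) //= eqxx muln1 big1 ?addn0 // => t.
by move=> /negPf->; rewrite muln0.
Qed.

Lemma sum_other_end (x : {ffun transition -> nat}) t0 :
  (\sum_t x t * (other_end t == t0) = x (other_end t0))%N.
Proof.
rewrite -sum_pick; apply: eq_bigr => -[a b] _; case: t0 => c d.
rewrite /other_end !xpair_eqE /= (can2_eq (@ord_predK _) (@ordSK _)).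
by rewrite (can2_eq (@ordSK _) (@ord_predK _)) andbC.
Qed.

(** Balance provides a matching [sigma] of corners at each vertex, and [closed_up] a matching [pi]
    of the ends of edges. Any matchings will do, since only numbers enter the bound. The boundary
    walks wind around [w] as often as [qs] records. *)
Lemma flow_bound e : (size half_edges <= (\sum_i y i + e).*2)%N ->
  exists2 qs, (sumn qs * L)%N = size half_edges &
    chain_bound [seq wval w ^+ q | q <- qs] e.
Proof.
move=> le_e; set n := size half_edges in le_e *.
pose dart : finType := 'I_n.
pose he (d : dart) := tnth (in_tuple half_edges) d.
have he_mem d : he d \in half_edges by apply: mem_tnth.
have enum_he : [seq he d | d <- enum dart] = half_edges.
  by rewrite -[RHS](map_tnth_enum (in_tuple half_edges)).
pose v d := (he d).1; pose tr d := (he d).2.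
have he_pos d : (0 < h (v d).1 (tr d))%N.
  have := he_mem d; rewrite /v /tr => /allpairsPdep[u [t [_ tin ->]]] /=.
  case/flatten_mapP: tin => t' _; rewrite mem_nseq => /andP[h0 /eqP->] //.
have tr_allowed d : allowed (tr d).
  apply: contraLR (he_pos d) => na; have [[zero _] _] := HsN (v d).1.
  by rewrite zero.
have countE (X : eqType) (f : vertex * transition -> X) x :
    count_mem x [seq f (he d) | d <- enum dart] =
    (\sum_(u <- vertices) \sum_t h u.1 t * (f (u, t) == x))%N.
  by rewrite [map _ _](map_comp f he) enum_he count_map count_half_edges.
have [sigma sigmaE] : exists sigma : {perm dart}, forall d,
    (v (sigma d), (tr (sigma d)).1) = (v d, (tr d).2).
  apply: (perm_reindex (f := fun d => (v d, (tr d).1)) (g := fun d => (v d, (tr d).2))).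
  apply: perm_count => -[u a].
  rewrite (countE _ (fun z => (z.1, z.2.2))) (countE _ (fun z => (z.1, z.2.1))).
  apply: eq_bigr => u' _; under eq_bigr do rewrite xpair_eqE /=.
  under [RHS]eq_bigr do rewrite xpair_eqE /=.
  have [_|_] := eqVneq u' u; last by rewrite !big1 // => t _; rewrite muln0.
  have [[_ bal] _] := HsN u'.1.
  rewrite (sum_fst (h u'.1)) (sum_snd (h u'.1)).
  exact: esym (bal a).
have [pi piE] : exists pi : {perm dart}, forall d, tr (pi d) = other_end (tr d).
  apply: (perm_reindex (f := tr) (g := fun d => other_end (tr d))).
  apply: perm_count => t.
  rewrite (countE _ (fun z => other_end z.2)) (countE _ (fun z => z.2)).
  under eq_bigr do rewrite /= sum_other_end.
  under [RHS]eq_bigr do rewrite /= sum_pick.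
  rewrite (sum_vertices (fun i => h i (other_end t))) (sum_vertices (fun i => h i t)).
  exact: y_closed.
pose lab d := cletter (tr d).1.
have lab_pi d : lab (pi d) = linv (lab d).
  by rewrite /lab piE; apply/eqP: (tr_allowed d).
have lab_piV d : lab ((pi^-1)%g d) = linv (lab d).
  by rewrite -{2}[d](permKV pi) lab_pi linvK.
have other_endK t : other_end (other_end t) = t :> transition.
  by case: t => a b; rewrite /other_end /= ord_predK ordSK.
have tr_piV d : tr ((pi^-1)%g d) = other_end (tr d).
  by rewrite -{2}[d](permKV pi) piE other_endK.
(* [pi] need not be an involution. It inverts labels, so taking it on positive letters and its
   inverse on negative ones gives an involution without fixed points. *)
pose tau d := if (lab d).2 then pi d else (pi^-1)%g d.
have lab_tau d : lab (tau d) = linv (lab d) by rewrite /tau; case: ifP.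
have tr_tau d : tr (tau d) = other_end (tr d) by rewrite /tau; case: ifP.
have tauK : involutive tau.
  move=> d; rewrite {1}/tau lab_tau /tau /=.
  by case: (lab d).2; rewrite /= ?permK ?permKV.
have tauN d : tau d != d.
  by apply/eqP => e'; have := lab_tau d; rewrite e' => /(congr1 snd) /=; case: (_.2).
pose rho d := sigma (tau d).
have v_rho d : v (rho d) = v (tau d) by have [] := sigmaE (tau d).
have tr_rho d : (tr (rho d)).1 = ordS (tr d).1.
  by have [_ ->] := sigmaE (tau d); rewrite tr_tau.
have rho_inj : injective rho.
  by move=> d d' /perm_inj; apply: inv_inj tauK _ _.
(* A fixed point would be an allowed transition from a corner to itself, excluded by [noloop]; thus
   each dart has a second one at its vertex. *)
have sigmaN d : sigma d != d.
  apply/eqP => e'; have [_] := sigmaE d; rewrite e' => e''.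
  by have := tr_allowed d; rewrite [tr d]surjective_pairing e'' (negPf (noloop _)).
pose ss := [seq orbit rho x | x <- enum (froots rho)].
have perm_fl := flatten_orbits rho_inj; rewrite -/ss in perm_fl.
have mem_fl d : d \in flatten ss by rewrite (perm_mem perm_fl) mem_enum.
have uniq_fl : uniq (flatten ss) by rewrite (perm_uniq perm_fl) enum_uniq.
have walk_traject x k : walk v tau (v x) (traject rho x k) (v (iter k rho x)).
  elim: k x => [|k IH] x; first by rewrite /= eqxx.
  by rewrite trajectS iterSr /= eqxx -v_rho; apply: IH.
have rg : ribbon_graph tau v (fun d => lval (lab d)) ss.
  split=> // [d _|_ /mapP[x _ ->]|d _].
  - by split; rewrite // lab_tau lval_inv.
  - exists (v x); have := walk_traject x (order rho x).
    by rewrite iter_order.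
  - rewrite (seq.permP (perm_filter_pair uniq_fl (mem_fl d) (mem_fl _) (sigmaN d))) /=.
    by have [-> _] := sigmaE d; rewrite eqxx.
have szfl : size (flatten ss) = n by rewrite (perm_size perm_fl) size_enum_ord.
have word_orbit x : (order rho x = order rho x %/ L * L)%N /\
    wval w ^+ (order rho x %/ L) =
    word (fun d => lval (lab d)) (orbit rho x) ^ (prefix_val w (tr x).1)^-1.
  have tr_iter k : (tr (iter k rho x)).1 = iter k (@ordS L) (tr x).1.
    by elim: k => //= k <-; rewrite tr_rho.
  have [q [+ +]] := wval_cyclic_walk (tr x).1 (order rho x).
  rewrite -tr_iter (iter_order rho_inj) addnC => /addIn oE prodE.
  have L0 : (0 < L)%N by apply: leq_ltn_trans (ltn_ord (tr x).1).
  rewrite oE mulnK //; split=> //.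
  have -> : word (fun d => lval (lab d)) (orbit rho x) =
      \prod_(0 <= j < order rho x) lval (cletter (iter j (@ordS L) (tr x).1)).
    rewrite /word /orbit; elim: (order rho x) => [|k IH].
      by rewrite big_nil big_geq.
    by rewrite trajectSr big_rcons big_nat_recr //= IH /lab tr_iter.
  by rewrite prodE conjgE !gsimpl.
exists [seq (order rho x %/ L)%N | x <- enum (froots rho)].
  rewrite -szfl size_flatten /shape -map_comp !sumnE !big_map big_distrl /=.
  by apply: eq_bigr => x _; rewrite size_orbit -(word_orbit x).1.
have bound : chain_bound [seq word (fun d => lval (lab d)) s | s <- ss] e.
  apply: ribbon_graph_bound rg _; rewrite szfl.
  apply: leq_trans le_e _; rewrite leq_double leq_add2r -size_vertices.
  apply: uniq_leq_size; first exact: uniq_vertices.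
  move=> u uin; rewrite mem_undup.
  have [t ht] : exists t, (0 < h u.1 t)%N.
    have [_ /eqP h0] := HsN u.1; apply: contrapT => nt; apply: h0.
    apply/ffunP => t; rewrite ffunE; apply/eqP; rewrite -leqn0 leqNgt.
    by apply/negP => ht; apply: nt; exists t.
  have : (u, t) \in half_edges.
    apply/allpairsPdep; exists u, t; split=> //; apply/flatten_mapP.
    by exists t; rewrite ?mem_enum // mem_nseq ht eqxx.
  rewrite -enum_he => /mapP[d _ e']; apply/mapP; exists d => //.
  by rewrite /v -e'.
rewrite -map_comp (_ : map _ _ = [seq word (fun d => lval (lab d)) (orbit rho x) ^
   (prefix_val w (tr x).1)^-1 | x <- enum (froots rho)]); last first.
  by apply: eq_map => x /=; rewrite (word_orbit x).2.
by apply: chain_bound_conjs; move: bound; rewrite /ss -map_comp.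
Qed.

End FlowSurface.

(** * Rationality *)

Section Rationality.
Variables (F : groupType) (B : set F).
Hypothesis B_free : free_basis B.

Definition cyclically_reduced (w : seq (letter F)) := cycle (fun a b => b != linv a) w.

Lemma reduced_power (w : seq (letter F)) N :
  cyclically_reduced w -> reduced (flatten (nseq N w)).
Proof.
case: w => [|x p]; first by elim: N.
rewrite /cyclically_reduced /= rcons_path => /andP[xp px].
suff H : path (fun a b => b != linv a) (last x p) (flatten (nseq N (x :: p))).
  by move: H; case: N => //= N /andP[].
by elim: N => //= N IH; rewrite px cat_path xp.
Qed.

Lemma cyclically_reducedP (w : seq (letter F)) :
  reflect (forall i : 'I_(size w), cletter (ordS i) != linv (cletter i))
    (cyclically_reduced w).
Proof.
case: w => [|x p]; first by apply: (iffP idP) => // _ [].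
have nthE (i : 'I_(size (x :: p))) : nth (1, true) (x :: rcons p x) i = cletter i /\
    nth (1, true) (rcons p x) i = cletter (ordS i).
  rewrite /cletter -rcons_cons nth_rcons ltn_ord /= nth_rcons; split=> //.
  have := ltn_ord i; rewrite ltnS leq_eqVlt => /predU1P[->|ip].
    by rewrite ltnn eqxx modnn.
  by rewrite ip modn_small.
apply: (iffP (pathP (1, true))) => H i.
  by have [<- <-] := nthE i; apply: H; rewrite size_rcons.
rewrite size_rcons => ip; have := H (Ordinal ip).
by have [<- <-] := nthE (Ordinal ip).
Qed.

Lemma cyclically_reduced_noloop (w : seq (letter F)) (a : 'I_(size w)) :
  cyclically_reduced w -> ~~ allowed ((a, a) : transition w).
Proof.
move/cyclically_reducedP => /(_ (ord_pred a)); rewrite ord_predK /allowed /=.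
by apply: contra => /eqP->; rewrite linvK.
Qed.

Lemma over_basis_power (w : seq (letter F)) N :
  over_basis B w -> over_basis B (flatten (nseq N w)).
Proof. by move=> ow l /flattenP[u /nseqP[-> _]]; apply: ow. Qed.

Lemma wval_power (w : seq (letter F)) N : wval (flatten (nseq N w)) = wval w ^+ N.
Proof.
elim: N => [|N IH]; first by rewrite /wval big_nil.
by rewrite /= wval_cat IH expgS.
Qed.

Theorem cyclically_reduced_rational w : over_basis B w -> cyclically_reduced w ->
  (0 < size w)%N -> commutator_subgroup (wval w) ->
  exists N e, stable_bounds (wval w) N e.
Proof.
move=> ow cw L0 /commutator_subgroupP[k0 ck0].
have [Hs [HsP gen]] := hilbert_basis (@vertex_flow_sub F w).
have surface n k : (0 < n)%N -> commutator_product k (wval w ^+ n) ->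
    exists V (y : {ffun 'I_(size Hs) -> nat}),
    [/\ closed_up y, (n * size w + 2 <= V.*2 + 4 * k)%N, (V <= \sum_i y i)%N &
       (\sum_t total_flow y t = n * size w)%N].
  move=> n0; rewrite -wval_power => ck.
  have [lab [tau [v [x [s [ps labs le]]]]]] := commutator_product_pairing B_free
    (over_basis_power ow) (reduced_power n cw) ck.
  have [y [cy Vy Xy]] := flow_of_pairing gen n0 L0 ps labs.
  exists (based_vertex_count v x s), y; split=> //.
  by rewrite -size_flatten_nseq -labs size_map.
pose b i := (\sum_t nth (vec0 (transition w)) Hs (i : 'I_(size Hs)) t)%N.
have XE (y : {ffun 'I_(size Hs) -> nat}) : (\sum_t total_flow y t = \sum_i y i * b i)%N.
  by rewrite exchange_big /=; apply: eq_bigr => i _; rewrite big_distrr.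
have b0 i : (0 < b i)%N.
  have [_ h0] := HsP _ (mem_nth (vec0 _) (ltn_ord i)).
  rewrite lt0n; apply: contra h0; rewrite sum_nat_eq0 => /forallP z.
  by apply/eqP/ffunP => t; rewrite ffunE; apply/eqP: (z t).
have [V1 [y1 [cy1 _ _ X1]]] := surface 1%N k0 isT ck0.
have y10 : y1 != vec0 _.
  apply: contraTneq L0 => y0; move: X1; rewrite mul1n => <-.
  by rewrite XE y0 big1 // => i _; rewrite ffunE mul0n.
have [ys [cys ys0 best]] :=
  best_ratio (@closed_up_sub _ _ Hs) (fun=> 1%N) b0 cy1 y10.
(* The graph of [ys] has [X / 2] edges; doubling the flow makes $-\chi$ the natural number
   [X - V.*2] without a parity argument. *)
pose y0 : {ffun 'I_(size Hs) -> nat} := [ffun i => ys i + ys i]%N.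
have total0 t : total_flow y0 t = (total_flow ys t + total_flow ys t)%N.
  by rewrite -big_split; apply: eq_bigr => i _; rewrite ffunE mulnDl.
have cy0 : closed_up y0 by move=> t; rewrite !total0 cys.
pose X := (\sum_t total_flow ys t)%N; pose V := (\sum_i ys i)%N.
have X0E : (\sum_t total_flow y0 t = X + X)%N.
  by rewrite -big_split; apply: eq_bigr => t _; rewrite total0.
have V0E : (\sum_i y0 i = V + V)%N.
  by rewrite -big_split; apply: eq_bigr => i _; rewrite ffunE.
have X0 : (0 < X)%N.
  rewrite lt0n; apply: contra ys0; rewrite /X XE sum_nat_eq0 => /forallP z.
  apply/eqP/ffunP => i; rewrite ffunE; have := z i.
  by rewrite muln_eq0 (gtn_eqF (b0 i)) orbF => /eqP.
have [|qs qsE] := flow_bound HsP (fun a => cyclically_reduced_noloop a cw) cy0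
  (e := (X - V.*2)%N).
  by rewrite size_half_edges X0E V0E; move: (X) (V) => x1 v1; clear; lia.
rewrite size_half_edges X0E in qsE => /chain_bound_powers[C up].
exists (sumn qs), (X - V.*2)%N; split.
- by rewrite lt0n; apply: contraTneq X0 => q0; move: qsE; rewrite q0 mul0n; case: (X).
- by exists C.
move=> n k ck; case: n ck => [|n] // ck.
have [Vb [y [cy le Vy Xy]]] := surface n.+1 k isT ck.
have := best _ cy; rewrite -!XE Xy -/X.
under eq_bigr do rewrite muln1; under [X in (_ <= X * _)%N -> _]eq_bigr do rewrite muln1.
rewrite -/V => ratio; rewrite -(leq_pmul2r L0).
have r2 : (Vb * X <= V * (n.+1 * size w))%N.
  by apply: leq_trans ratio; rewrite leq_mul2r Vy orbT.
have -> : (2 * sumn qs * k * size w = 2 * (X + X) * k)%N by rewrite -qsE; nia.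
rewrite mulnAC; move: (n.+1 * size w)%N le r2 => m le r2.
(* Where the subtraction is truncated, [e] is zero and the lower bound trivial. *)
have [XV|VX] := leqP X V.*2; first by rewrite (eqP (_ : X - V.*2 == 0)%N) ?muln0.
move: le r2 VX; clear; move: (X) (V) => x1 v1 le r2 VX; rewrite mulnBr -muln2.
have : (m * x1 + 2 * x1 <= Vb * x1 * 2 + 4 * k * x1)%N.
  by rewrite -mulnDl (leq_trans (leq_mul le (leqnn x1))) // -muln2; nia.
by nia.
Qed.

Lemma linv_neq (a : letter F) : a != linv a.
Proof. by case: a => x b; rewrite /linv xpair_eqE eqxx /=; case: b. Qed.

(** Inverse neighbours are cancelled, and an inverse pair formed by the last and first letters is
    removed by a conjugation; both shorten the word. *)
Lemma conj_cyclically_reduced (g : F) : exists w h,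
  [/\ over_basis B w, cyclically_reduced w & g = wval w ^ h].
Proof.
have [u ou ->] := basis_spans B_free g.
have [n] := ubnP (size u); elim: n u ou => // n IH u ou; rewrite ltnS => le_n.
have [cu|] := boolP (cyclically_reduced u); first by exists u, 1; rewrite conjg1.
case: u ou le_n => // x p ou le_n.
rewrite /cyclically_reduced /= rcons_path negb_and negbK => /orP[nr|/eqP xl].
  have [u1 [a [b [u2 [uE ba]]]]] : exists u1 a b u2,
      x :: p = u1 ++ a :: b :: u2 /\ b = linv a.
    elim: p x nr {ou le_n} => //= y p IHp x; rewrite negb_and negbK.
    case/orP=> [/eqP yx|/IHp[u1 [a [b [u2 [-> ba]]]]]].
      by exists [::], x, y, p.
    by exists (x :: u1), a, b, u2.
  have -> : wval (x :: p) = wval (u1 ++ u2).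
    by rewrite uE ba !wval_cat !wval_cons lval_inv mulVKg.
  apply: IH; first by move=> l lu; apply: ou; rewrite uE mem_cat !inE;
    move: lu; rewrite mem_cat => /orP[->|->]; rewrite ?orbT.
  by apply: leq_trans le_n; rewrite uE !size_cat /= !addnS.
case/lastP: p xl ou le_n => [|p l] /=; first by move/eqP; rewrite (negPf (linv_neq x)).
rewrite last_rcons => -> ou le_n.
have -> : wval (linv l :: rcons p l) = wval p ^ lval l.
  by rewrite -cats1 wval_cons wval_cat lval_inv conjgE [wval [:: l]]big_seq1.
have [||w [h [ow cw ->]]] := IH p.
- by move=> l' l'p; apply: ou; rewrite inE mem_rcons inE l'p !orbT.
- by rewrite size_rcons in le_n; exact: ltnW.
by exists w, (h * lval l); rewrite conjgM.
Qed.

Theorem scl_rational (g : F) : commutator_subgroup g -> exists N e, stable_bounds g N e.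
Proof.
move=> cg; have [w [h [ow cw gE]]] := conj_cyclically_reduced g.
have [w0|L0] := posnP (size w).
  exists 1%N, 0%N; rewrite gE (size0nil w0) [wval _]big_nil conj1g.
  split=> // [|n k _]; last by rewrite muln0.
  by exists 0%N => m; rewrite expg1n muln0; apply: commutator_product0.
have [|N [e sb]] := cyclically_reduced_rational ow cw L0.
  move/commutator_subgroupP: cg => [k ck]; apply/commutator_subgroupP; exists k.
  by rewrite -[wval w](conjgK h) -gE; apply: commutator_productJ.
by exists N, e; rewrite gE; apply: stable_boundsJ.
Qed.

End Rationality.

(** * The vertices of a surgery word *)

(* A class of vertices with more vertices than edges is a tree, and carries a
   height function; the list [good] collects the trees. *)
Lemma forest_heights (T : eqType) (vs : seq T) (es : seq (T * T)) : uniq vs ->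
  exists (c : T -> T) (ht : T -> int) (good : seq T),
    [/\ uniq good, {in good, forall g, exists2 u, u \in vs & c u = g},
        (size vs <= size good + size es)%N &
        {in es, forall e, c e.1 = c e.2 /\
          (c e.1 \in good -> ht e.2 = (ht e.1 + 1)%R)}].
Proof.
move=> uvs; elim: es => [|[p r] es [c [ht [good [ug sub le ok]]]]].
  by exists id, (fun=> 0%R), vs; split=> //= [g gvs|]; [exists g|rewrite addn0].
(* An edge between two different trees joins them, after a shift of the heights in one. Any other
   edge meets at most one tree, which is struck off. Either way the number of trees drops by at most
   one. *)
have [/and3P[cpr gp gr]|bad] := boolP [&& c p != c r, c p \in good & c r \in good].
  pose c' u := if c u == c r then c p else c u.
  pose ht' u := if c u == c r then (ht u + (ht p + 1 - ht r))%R else ht u.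
  exists c', ht', (rem (c r) good); split.
  - exact: rem_uniq.
  - move=> g; rewrite mem_rem_uniq // inE => /andP[gr' /sub[u uvs' cu]].
    by exists u => //; rewrite /c' cu (negPf gr').
  - rewrite size_rem //= addnS -addSn prednK //.
    by rewrite lt0n size_eq0; apply: contraTneq gr => ->.
  - move=> e; rewrite inE => /predU1P[->|/ok[ce he]] /=.
      rewrite /c' /ht' eqxx (negPf cpr); split=> // _.
      by rewrite addrCA subrr addr0.
    rewrite /c' /ht' -ce; case: eqP => [cer|_]; split=> //.
      by move=> _; rewrite he ?cer // addrAC.
    by move=> eg; apply: he; apply: mem_rem eg.
pose c' u := if c u == c r then c p else c u.
exists c', ht, [seq g <- good | g \notin [:: c p; c r]]; split.
- exact: filter_uniq.
- move=> g; rewrite mem_filter !inE negb_or => /andP[/andP[_ gr] /sub[u uvs' cu]].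
  by exists u => //; rewrite /c' cu (negPf gr).
- apply: leq_trans le _; rewrite /= addnS -addSn leq_add2r size_filter.
  rewrite -(count_predC (mem [:: c p; c r]) good) addnC -addn1 leq_add2l.
  rewrite -size_filter leqNgt; apply: contra bad => two.
  have := filter_uniq (mem [:: c p; c r]) ug; move: two.
  set F := [seq _ <- _ | _] => two uF.
  have subF : {subset F <= [:: c p; c r]} by move=> z; rewrite mem_filter => /andP[].
  have [|szF eF] := uniq_min_size uF subF; first by [].
  have cpF : c p \in F by rewrite eF !inE eqxx.
  have crF : c r \in F by rewrite eF !inE eqxx orbT.
  move: (cpF) (crF); rewrite !mem_filter => /andP[_ ->] /andP[_ ->].
  rewrite !andbT; apply: contraTneq two => e; rewrite -leqNgt.
  rewrite -[1%N]/(size [:: c p]); apply: uniq_leq_size => // z /subF.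
  by rewrite !inE -e orbb.
move=> e; rewrite inE => /predU1P[->|/ok[ce he]] /=.
  rewrite /c' eqxx; case: eqP => [->|_]; split=> //.
    by rewrite mem_filter !inE eqxx.
  by rewrite mem_filter !inE eqxx.
rewrite /c' -ce; case: eqP => [_|_]; split=> //.
  by rewrite mem_filter !inE eqxx.
by rewrite mem_filter => /andP[_ /he].
Qed.

Lemma sub_in_count (T : eqType) (P Q : pred T) s :
  {in s, forall d, P d -> Q d} -> (count P s <= count Q s)%N.
Proof.
elim: s => //= d s IH sub; rewrite leq_add ?IH //.
  by case: (P d) (sub d (mem_head _ _)) => // ->.
by move=> d' d's; apply: sub; rewrite inE d's orbT.
Qed.

Lemma sum_count_seq_le (D T : eqType) (Q : pred D) (f : D -> T) s U : uniq U ->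
  (\sum_(u <- U) count (fun d => (f d == u) && Q d) s <= count Q s)%N.
Proof.
move=> uU; elim: s => [|d s IH] /=; first by rewrite big1.
rewrite big_split /= leq_add //.
have [dU|dU] := boolP (f d \in U).
  rewrite (bigD1_seq (f d)) //= eqxx big1 ?addn0 // => u /negPf.
  by rewrite eq_sym => ->.
by rewrite big_seq big1 // => u uin; case: eqP => // e; rewrite e uin in dU.
Qed.

(* Around a closed walk in a tree the steps [+ 1] are [n] times as many as the
   steps [- n], so most of them follow one another. *)
Lemma balanced_steps (D : eqType) (S : seq D) (T : D -> D) (x z : pred D)
    (ht : D -> int) n :
  uniq S -> {in S, forall d, T d \in S} -> {in S &, injective T} ->
  {in S, forall d, z (T d) = x d} ->
  {in S, forall d, ht (T d) = (ht d + (if x d then 1 else - n%:Z))%R} ->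
  (0 < size S)%N -> (n.-1 <= count (fun d => x d && z d) S)%N.
Proof.
move=> uS TS Tinj zT htT S0; have pT := perm_in_map uS TS Tinj.
have sum0 : (\sum_(d <- S) (if x d then 1 else - n%:Z) = 0 :> int)%R.
  have : (\sum_(d <- S) ht (T d) = \sum_(d <- S) ht d)%R.
    by rewrite -[RHS](perm_big _ pT) big_map.
  rewrite (eq_big_seq _ htT) big_split /= => /eqP.
  rewrite -subr_eq0 addrAC subrr add0r.
  by move/eqP.
have cx : count x S = (n * count (predC x) S)%N.
  have E : (\sum_(d <- S) (if x d then 1 else - n%:Z) =
      (count x S)%:Z - n%:Z * (count (predC x) S)%:Z :> int)%R.
    elim: (S) => [|d s IH]; first by rewrite big_nil mulr0 subr0.
    by rewrite big_cons IH /=; case: (x d) => /=; rewrite ?add0n PoszD ?mulrDr; lia.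
  by move: sum0; rewrite E; lia.
have cz : count z S = count x S.
  by rewrite -(seq.permP pT) count_map; apply: eq_in_count => d /zT.
(* With $k \ge 1$ steps [- n] there are $nk$ steps [+ 1], and exactly $k$ elements fail [z]; hence
   at least $(n-1)k$ satisfy both. *)
have c1 : (count x S <= count (fun d => x d && z d) S + count (predC z) S)%N.
  by elim: (S) => //= d s IH; case: (x d); case: (z d) => /=; lia.
have cX := count_predC x S; have cZ := count_predC z S.
have : (0 < count (predC x) S)%N.
  by rewrite lt0n; apply: contraTneq S0 => e; move: cX; rewrite cx e muln0 => <-.
by move: c1 cX cZ cx cz; nia.
Qed.

Section SurgeryPositions.
Variable n : nat.
Implicit Types i j : nat.

(** Positions in $a\,b\,a^{-1} b^{-1} a\,b^{-n} a^{-1} b^n$: the letters $a$ stand at $0$ and $4$,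
    the letters $a^{-1}$ at $2$ and $n + 5$. For the run of letters $b^{\pm1}$ behind each of them,
    the definitions below record the length, the $a$-letter that ends it and the exponent sum. *)
Definition out_pos i := (i == 0) || (i == 4).
Definition in_pos i := (i == 2) || (i == n + 5)%N.
Definition arc_length i := if (i == 0) || (i == 2) then 1%N else n.
Definition next_pos i :=
  if i == 0 then 2 else if i == 2 then 4 else if i == 4 then (n + 5)%N else 0.
Definition exponent i : int :=
  (if i == 0 then 1 else if i == 2 then -1 else if i == 4 then - n%:Z else n%:Z)%R.

Lemma int_step (x : int) k (sg : bool) :
  (x + (if sg then k%:Z else - k%:Z) + (if sg then 1 else -1) =
   x + (if sg then k.+1%:Z else - k.+1%:Z))%R.
Proof. by case: sg; lia. Qed.

Lemma end_of_arc i : out_pos i || in_pos i ->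
  ((i + (arc_length i).+1) %% (n.*2 + 6) = next_pos i)%N.
Proof.
rewrite /out_pos /in_pos /arc_length /next_pos => /orP[]/orP[]/eqP-> /=.
- by rewrite modn_small //; lia.
- by rewrite modn_small; lia.
- by rewrite modn_small //; lia.
- do 4?[rewrite ifF; last by lia].
  have -> : (n + 5 + n.+1 = n.*2 + 6)%N by lia.
  exact: modnn.
Qed.

Lemma inside_arc i j : out_pos i || in_pos i -> (j < arc_length i)%N ->
  [/\ (i + j.+1 < n.*2 + 6)%N, ~~ out_pos (i + j.+1), ~~ in_pos (i + j.+1) &
   (i + j.+1 == 1%N) || (n + 5 < i + j.+1)%N = ((i == 0) || (i == n + 5)%N)].
Proof.
rewrite /out_pos /in_pos /arc_length => ipos jlt.
case/orP: ipos jlt => /orP[] /eqP-> /=.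
- by split; lia.
- by split; lia.
- by split; lia.
- by rewrite ifF => [|]; [split; lia|lia].
Qed.

Lemma exponent_arc i : out_pos i || in_pos i ->
  (if (i == 0) || (i == n + 5)%N then (arc_length i)%:Z else - (arc_length i)%:Z)%R =
  exponent i.
Proof.
rewrite /out_pos /in_pos /arc_length /exponent => ipos.
case/orP: ipos => /orP[] /eqP-> //=.
- by rewrite ifF //; lia.
- by rewrite ifF //; lia.
- by rewrite eqxx orbT !ifF //; lia.
Qed.

Lemma out_in i : out_pos i -> in_pos i = false.
Proof. by rewrite /out_pos /in_pos => /orP[] /eqP->; lia. Qed.

Lemma exponent_in i : in_pos i ->
  exponent i = (- (if i == 2 then 1 else - n%:Z))%R.
Proof.
rewrite /in_pos /exponent => /orP[] /eqP-> //=.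
by rewrite !ifF ?opprK //; lia.
Qed.

Lemma exponent_out i : out_pos i -> exponent i = (if i == 0 then 1 else - n%:Z)%R.
Proof. by rewrite /out_pos /exponent => /orP[] /eqP->. Qed.

Lemma next_of_in i : in_pos i ->
  out_pos (next_pos i) /\ (next_pos i == 4) = (i == 2).
Proof.
rewrite /in_pos /out_pos /next_pos => /orP[] /eqP-> //=.
by rewrite !ifF ?eqxx; try lia; split=> //; lia.
Qed.

Lemma next_of_out i : out_pos i ->
  in_pos (next_pos i) /\ (next_pos i == 2) = (i == 0).
Proof.
rewrite /in_pos /out_pos /next_pos => /orP[] /eqP-> //=.
by rewrite eqxx orbT; split=> //; lia.
Qed.

Lemma next_pos_inj i j : out_pos i || in_pos i -> out_pos j || in_pos j ->
  next_pos i = next_pos j -> i = j.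
Proof.
have nE k : out_pos k || in_pos k -> [\/ k = 0 /\ next_pos k = 2,
    k = 2 /\ next_pos k = 4, k = 4 /\ next_pos k = (n + 5)%N |
    k = (n + 5)%N /\ next_pos k = 0].
  rewrite /in_pos /out_pos /next_pos => /orP[]/orP[]/eqP-> /=.
  - by apply: Or41.
  - by apply: Or43.
  - by apply: Or42.
  - by apply: Or44; rewrite !ifF //; lia.
by move=> /nE + /nE => -[[-> ->]|[-> ->]|[-> ->]|[-> ->]]
  [[-> ->]|[-> ->]|[-> ->]|[-> ->]]; lia.
Qed.

End SurgeryPositions.

Section SurgeryWord.
Variables (F : groupType) (a b : F).

Definition surgery_word n : seq (letter F) :=
  [:: (a, true); (b, true); (a, false); (b, false); (a, true)] ++
  nseq n (b, false) ++ (a, false) :: nseq n (b, true).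

Lemma size_surgery_word n : size (surgery_word n) = (n.*2 + 6)%N.
Proof. by rewrite /= size_cat /= !size_nseq; lia. Qed.

Lemma surgery_letter n (i : 'I_(size (surgery_word n))) :
  cletter i = if (i == 0 :> nat) || (i == 4 :> nat) then (a, true)
    else if (i == 2 :> nat) || (i == n + 5 :> nat)%N then (a, false)
    else (b, (i == 1%N :> nat) || (n + 5 < i)%N).
Proof.
have := ltn_ord i; rewrite [X in (_ < X)%N -> _]size_surgery_word /cletter.
move: (nat_of_ord i) => j; rewrite /surgery_word !addnS !addn0 => jlt.
do 5![case: j jlt => [|j] jlt //=]; rewrite nth_cat size_nseq nth_nseq.
rewrite !eqSS !ltnS.
case: ltngtP => [lt|lt|->] //; last by rewrite subnn.
rewrite -[(j - n)%N]prednK ?subn_gt0 //= nth_nseq ifT //; lia.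
Qed.

Lemma surgery_word_cyclically_reduced n : a != b -> (0 < n)%N ->
  cyclically_reduced (surgery_word n).
Proof.
move=> ab n0; apply/cyclically_reducedP => i; rewrite !surgery_letter.
rewrite -[nat_of_ord (ordS i)]/(i.+1 %% size (surgery_word n))%N.
have := ltn_ord i; move: (nat_of_ord i) => j; rewrite size_surgery_word => jlt {i}.
have ba : (b == a) = false by rewrite eq_sym (negPf ab).
have jE : (j.+1 %% (n.*2 + 6) = if j.+1 == n.*2 + 6 then 0 else j.+1)%N.
  by case: eqP => [->|ne]; [rewrite modnn|rewrite modn_small //; lia].
move: jE; set j' := (_ %% _)%N => jE.
have notconsec : ~~ (((j' == 0) || (j' == 4) || (j' == 2) || (j' == n + 5)%N) &&
    ((j == 0) || (j == 4) || (j == 2) || (j == n + 5)%N)).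
  by rewrite jE; case: (eqVneq j.+1); lia.
move: notconsec; case: ifP => A1; [|case: ifP => A2]; (case: ifP => B1; [|case: ifP => B2]).
all: rewrite ?orbT //= => _; rewrite /linv /= xpair_eqE ?(negPf ab) ?ba ?eqxx //=.
suff -> : (j' == 1%N) || (n + 5 < j')%N = (j == 1%N) || (n + 5 < j)%N by case: (_ || _).
by move: A1 A2 B1 B2; rewrite jE; case: (eqVneq j.+1); lia.
Qed.

Lemma count_surgery_word n : a != b -> count_mem (b, true) (surgery_word n) = n.+1.
Proof.
move=> ab; rewrite /= count_cat /= !count_nseq /= !xpair_eqE !eqxx (negPf ab) /=.
by lia.
Qed.

(** Without the $a$-edges there remain [N * n.+1] edges, one for each letter $b$, so $V$ is at most
    this number plus the number of trees. Each tree consumes at least [n.-1] of the [N] occurrences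
    of the letter at position $2$. *)
Lemma surgery_vertex_bound n (D T : eqType) (lab : D -> letter F) tau (v : D -> T) x s N :
  a != b -> (0 < N)%N -> pairing lab tau v x s ->
  map lab s = flatten (nseq N (surgery_word n)) ->
  (n.-1 * based_vertex_count v x s <= N * (1 + n.-1 * n.+1))%N.
Proof.
move=> ab N0 ps labs; have L0 : (0 < size (surgery_word n))%N by [].
have [rho [p [rho_s rho_inj p_rho lab_p v_rho]]] := pairing_rotation N0 L0 ps labs.
have ptau := perm_tau ps; have [us Htau wk] := ps.
have prho := perm_in_map us rho_s rho_inj.
set L := size (surgery_word n) in L0 p p_rho lab_p.
have LE : L = (n.*2 + 6)%N := size_surgery_word n.
have modL i : (i %% L = i %% (n.*2 + 6))%N by rewrite LE.
have tau_s d : d \in s -> tau d \in s by case/Htau.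
have tauK d : d \in s -> tau (tau d) = d by case/Htau.
have iter_s k d : d \in s -> iter k rho d \in s by move=> ds; elim: k => //= k; apply: rho_s.
have p_iter k d : d \in s -> p (iter k rho d) = ((p d + k) %% L)%N :> nat.
  move=> ds; elim: k => [|k IH]; first by rewrite addn0 modn_small.
  by rewrite iterS p_rho ?iter_s //= IH -addn1 modnDml addn1 addnS.
pose out d := out_pos (p d); pose inn d := in_pos n (p d).
have labE d : d \in s -> lab d = if out d then (a, true) else
    if inn d then (a, false) else (b, (p d == 1%N :> nat) || (n + 5 < p d)%N).
  by move=> ds; rewrite lab_p // surgery_letter.
have ba : (b == a) = false by rewrite eq_sym (negPf ab).
have tau_out d : d \in s -> out d -> inn (tau d).
  move=> ds od; have [_ _ _] := Htau d ds; rewrite !labE ?tau_s // od.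
  by case: (out (tau d)); case: (inn (tau d)) => //; rewrite /linv => -[] // e; rewrite e eqxx in ba.
have tau_inn d : d \in s -> ~~ out d -> inn d -> out (tau d).
  move=> ds od id; have [_ _ _] := Htau d ds; rewrite !labE ?tau_s // (negPf od) id.
  by case: (out (tau d)); case: (inn (tau d)) => //; rewrite /linv => -[] // e; rewrite e eqxx in ba.
pose es := [seq (v d, v (tau d)) | d <- s & lab d == (b, true)].
have [c [ht [good [ugood good_vs le_good es_ok]]]] :=
  forest_heights es (undup_uniq (map v s)).
have bstep d : d \in s -> ~~ out d -> ~~ inn d -> c (v (rho d)) = c (v d) /\
    (c (v d) \in good -> ht (v (rho d)) = (ht (v d) + (if (lab d).2 then 1 else -1))%R).
  move=> ds od id; rewrite v_rho //; have := labE d ds.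
  rewrite (negPf od) (negPf id); set sg := (_ || _); case: sg => labd.
    have eds : (v d, v (tau d)) \in es.
      by apply: map_f; rewrite mem_filter labd eqxx.
    by have [/= <- H] := es_ok _ eds; rewrite labd.
  have eds : (v (tau d), v d) \in es.
    rewrite -{2}(tauK d ds); apply: (map_f (fun d => (v d, v (tau d)))).
    have [_ _ _ labt] := Htau d ds.
    by rewrite mem_filter labt labd tau_s ?eqxx.
  have [/= e H] := es_ok _ eds; rewrite e; split=> // cg.
  by rewrite labd H ?e // addrK.
have bwalk d k sg : d \in s ->
    (forall j, (j < k)%N -> let f := iter j rho d in
       [/\ ~~ out f, ~~ inn f & (lab f).2 = sg]) ->
    c (v (iter k rho d)) = c (v d) /\
    (c (v d) \in good -> ht (v (iter k rho d)) =
       (ht (v d) + (if sg then k%:Z else - k%:Z))%R).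
  move=> ds; elim: k => [|k IH] H; first by split=> // _; case: sg {H}; rewrite addr0.
  have [|ck hk] := IH _; first by move=> j jk; apply: H; apply: ltnW.
  have [of_ inf sgf] := H k (ltnSn k).
  have [e he] := bstep _ (iter_s k d ds) of_ inf.
  rewrite iterS e ck; split=> // cg; rewrite he ?ck // hk // sgf.
  exact: int_step.
pose J d := iter (arc_length n (p d)).+1 rho d.
have J_s d : d \in s -> J d \in s by apply: iter_s.
have p_J d : d \in s -> out d || inn d -> p (J d) = next_pos n (p d) :> nat.
  by move=> ds od; rewrite /J p_iter // modL end_of_arc.
have arc d : d \in s -> out d || inn d -> c (v (J d)) = c (v (tau d)) /\
    (c (v (tau d)) \in good -> ht (v (J d)) = (ht (v (tau d)) + exponent n (p d))%R).
  move=> ds od; rewrite -v_rho // /J iterSr.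
  have [|e he] := bwalk (rho d) (arc_length n (p d))
      ((p d == 0 :> nat) || (p d == n + 5 :> nat)%N) (rho_s d ds).
    move=> j /(inside_arc od)[lt nout ninn sgE] f; have fs : f \in s by apply/iter_s/rho_s.
    have pf : p f = (p d + j.+1)%N :> nat.
      by rewrite /f -iterSr p_iter // modL modn_small.
    by rewrite labE // /out /inn pf (negPf nout) (negPf ninn).
  by split=> // /he->; rewrite exponent_arc.
(* When [tau d] enters the component that [d] leaves, the walk goes on along letters $b^{\pm1}$
   inside it, and [T' d] is the $a$-dart by which it leaves again. *)
pose T' d := J (tau d).
have iter_inj k d d' : d \in s -> d' \in s -> iter k rho d = iter k rho d' -> d = d'.
  by move=> ds ds'; elim: k => // k IH /rho_inj e; apply: IH; apply: e; apply: iter_s.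
have T_inj d d' : d \in s -> d' \in s -> out (tau d) || inn (tau d) ->
    out (tau d') || inn (tau d') -> T' d = T' d' -> d = d'.
  move=> ds ds' od od' e.
  have pe : p (tau d) = p (tau d').
    apply: val_inj => /=; apply: (next_pos_inj od od').
    by rewrite -!p_J ?tau_s // -/(T' d) e.
  have := e; rewrite /T' /J pe => /iter_inj te.
  by rewrite -(tauK d ds) te ?tau_s // tauK.
have T_s d : d \in s -> T' d \in s by move=> ds; apply/J_s/tau_s.
have T_arc d : d \in s -> out (tau d) || inn (tau d) -> c (v (T' d)) = c (v d) /\
    (c (v d) \in good -> ht (v (T' d)) = (ht (v d) + exponent n (p (tau d)))%R).
  by move=> ds od; have := arc _ (tau_s _ ds) od; rewrite tauK.
have good_arc g : g \in good -> exists2 d, d \in s & (out d || inn d) && (c (v d) == g).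
  (* Otherwise the walk would stay in the component forever, although it must reach position $0$, a
     letter $a$. *)
  move=> /good_vs[u]; rewrite mem_undup => /mapP[d ds ->] cd.
  apply: contrapT => none.
  have all_g k : c (v (iter k rho d)) = g.
    elim: k => // k IH; rewrite iterS; have ks := iter_s k d ds.
    have [od|od] := boolP (out (iter k rho d)).
      by case: none; exists (iter k rho d); rewrite ?IH ?od ?eqxx.
    have [id|id] := boolP (inn (iter k rho d)).
      by case: none; exists (iter k rho d); rewrite ?IH ?id ?orbT ?eqxx.
    by have [-> _] := bstep _ ks od id.
  apply: none; exists (iter (L - p d) rho d); first exact: iter_s.
  by rewrite all_g eqxx andbT /out p_iter // subnKC ?modnn // ltnW.
(* Both count pairings of the letter $a^{-1}$ at position $2$: in [Q1] with position $4$, in [Q2]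
   with position $0$. Together they are at most the [N] occurrences of that letter. *)
pose Q1 d := (p d == 4 :> nat) && (p (tau d) == 2 :> nat).
pose Q2 d := (p d == 2 :> nat) && (p (tau d) == 0 :> nat).
have half g (S : seq D) (y z : pred D) (sg : bool) : g \in good -> uniq S ->
    (forall d, d \in S -> [/\ d \in s, c (v d) = g, out (tau d) || inn (tau d),
       T' d \in S & z (T' d) = y d]) ->
    (forall d, d \in S -> exponent n (p (tau d)) =
       (if sg then (if y d then 1 else - n%:Z) else - (if y d then 1 else - n%:Z))%R) ->
    (0 < size S)%N -> (n.-1 <= count (fun d => y d && z d) S)%N.
  move=> ggood uS SP expE S0.
  apply: (@balanced_steps _ S T' y z (fun d => if sg then ht (v d) else - ht (v d))%R n) => //.
  - by move=> d /SP[].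
  - by move=> d d' /SP[ds _ od _ _] /SP[ds' _ od' _ _]; apply: T_inj.
  - by move=> d /SP[].
  - move=> d dS; have [ds cd od _ _] := SP d dS; have [_ ->] := T_arc d ds od.
      by rewrite expE //; case: (sg) => //; rewrite opprD opprK.
    by rewrite cd.
have tree g : g \in good -> (n.-1 <=
    count (fun d => (c (v d) == g) && Q1 d) s + count (fun d => (c (v d) == g) && Q2 d) s)%N.
  move=> gg; have [d ds /andP[/orP[od|id] cd]] := good_arc g gg.
    apply: leq_trans (leq_addr _ _).
    pose S := [seq d <- s | out d && (c (v d) == g)].
    apply: (@leq_trans (count (fun d => (p (tau d) == 2 :> nat) && (p d == 4 :> nat)) S)).
      apply: (half g S _ _ false) => //; first exact: filter_uniq.
      + move=> d'; rewrite mem_filter => /andP[/andP[od' /eqP cd'] ds'].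
        have it := tau_out _ ds' od'; have oit : out (tau d') || inn (tau d') by rewrite it orbT.
        have [cT _] := T_arc _ ds' oit.
        have pT := p_J _ (tau_s _ ds') oit; have [n1 n2] := next_of_in it.
        by rewrite mem_filter T_s // cT cd' eqxx /out /T' pT n1 n2.
      + move=> d'; rewrite mem_filter => /andP[/andP[od' _] ds'].
        exact/exponent_in/tau_out.
      + by rewrite -has_predT; apply/hasP; exists d; rewrite // mem_filter od cd.
    rewrite count_filter; apply: sub_count => d' /= /andP[/andP[h1 h2] /andP[_ ->]].
    by rewrite /Q1 h1 h2.
  apply: leq_trans (leq_addl _ _).
  pose S := [seq d <- s | inn d && (c (v d) == g)].
  apply: (@leq_trans (count (fun d => (p (tau d) == 0 :> nat) && (p d == 2 :> nat)) S)).
    apply: (half g S _ _ true) => //; first exact: filter_uniq.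
    + move=> d'; rewrite mem_filter => /andP[/andP[id' /eqP cd'] ds'].
      have od' : ~~ out d' by apply: contraTN id' => /(out_in n); rewrite /inn => ->.
      have ot := tau_inn _ ds' od' id'; have oit : out (tau d') || inn (tau d') by rewrite ot.
      have [cT _] := T_arc _ ds' oit.
      have pT := p_J _ (tau_s _ ds') oit; have [n1 n2] := next_of_out n ot.
      by rewrite mem_filter T_s // cT cd' eqxx /inn /T' pT n1 n2.
    + move=> d'; rewrite mem_filter => /andP[/andP[id' _] ds'].
      have od' : ~~ out d' by apply: contraTN id' => /(out_in n); rewrite /inn => ->.
      exact/exponent_out/tau_inn.
    + by rewrite -has_predT; apply/hasP; exists d; rewrite // mem_filter id cd.
  rewrite count_filter; apply: sub_count => d' /= /andP[/andP[h1 h2] /andP[_ ->]].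
  by rewrite /Q2 h1 h2.
have szs : size s = (N * L)%N by rewrite -(size_map lab) labs size_flatten_nseq.
have countp j : (j < L)%N -> count (fun d => p d == j :> nat) s = N.
  have const i : (i < L)%N -> count (fun d => p d == i :> nat) s =
      count (fun d => p d == 0 :> nat) s.
    elim: i => // i IH iL; rewrite -IH ?(ltnW iL) // -[LHS](seq.permP prho) count_map.
    apply: eq_in_count => d ds; rewrite /= p_rho //=.
    have := ltn_ord (p d); rewrite -/L leq_eqVlt => /predU1P[e|lt].
      by rewrite e modnn; apply/esym/eqP => e'; move: iL; rewrite -e' e ltnn.
    by rewrite modn_small.
  move=> jL; rewrite const //; apply/eqP; rewrite -(eqn_pmul2l L0) [X in _ == X]mulnC.
  rewrite -szs -count_predT -(sum_count predT p).
  rewrite (eq_bigr (fun=> count (fun d => p d == 0 :> nat) s)) => [|i _].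
    by rewrite sum_nat_const card_ord.
  by rewrite -(const i) //; apply: eq_count => d /=; rewrite -val_eqE.
have good_le : (size good * n.-1 <= N)%N.
  apply: (@leq_trans (count Q1 s + count Q2 s)).
    apply: leq_trans (leq_add (sum_count_seq_le Q1 (c \o v) s ugood)
      (sum_count_seq_le Q2 (c \o v) s ugood)).
    rewrite -big_split /= -sum1_size big_distrl /= big_seq [X in (_ <= X)%N]big_seq.
    by apply: leq_sum => g gg; rewrite mul1n; apply: tree.
  rewrite -(countp 2) //.
  rewrite -[X in (X + _)%N](seq.permP ptau) count_map.
  rewrite -(count_predUI (preim tau Q1) Q2) [X in (_ + X)%N](_ : _ = 0%N) ?addn0.
    apply: sub_in_count => d ds /=.
    by rewrite /Q1 /Q2 tauK // => /orP[/andP[_ ->]|/andP[->]].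
  apply/eqP; rewrite -leqn0 leqNgt -has_count; apply/hasPn => d ds /=.
  by rewrite /Q1 /Q2; case: eqP => // ->; rewrite /= !andbF.
have szes : size es = (N * n.+1)%N.
  rewrite size_map size_filter -(count_surgery_word n ab).
  have -> : count (fun d => lab d == (b, true)) s = count_mem (b, true) (map lab s).
    by rewrite count_map.
  by rewrite labs count_flatten map_nseq sumn_nseq mulnC.
have s0 : (0 < size s)%N by rewrite szs muln_gt0 N0.
have -> : based_vertex_count v x s = size (undup (map v s)).
  rewrite /based_vertex_count; case: (s) wk s0 => //= d s' /andP[/eqP-> _] _.
  by rewrite mem_head.
move: le_good; rewrite szes; move: (size (undup _)) (size good) good_le; clear.
by move=> V gd; nia.
Qed.

End SurgeryWord.

(** * A surface for a surgery word *)

Section SurgeryChain.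
Variable G : groupType.
Implicit Types (a b g h x y : G) (s : seq G) (e i j k m n : nat).

Lemma chain_bound_rotate g h s e :
  (exists u, h = g ^ u) -> chain_bound (h :: s) e -> chain_bound (g :: s) e.
Proof.
move=> [u ->] H; have := chain_bound_conj u^-1 H; by rewrite conjgK.
Qed.

(** The copies of [x * y] are merged one at a time into $x^i y^i$, with one pair of pants for each
    copy after the first. *)
Lemma chain_bound_power_split x y j s e :
  chain_bound (x ^+ j.+1 * y ^+ j.+1 :: s) e ->
  chain_bound (nseq j.+1 (x * y) ++ s) (e + j).
Proof.
suff H i : chain_bound (x ^+ (i + j).+1 * y ^+ (i + j).+1 :: s) e ->
    chain_bound (x ^+ i.+1 * y ^+ i.+1 :: nseq j (x * y) ++ s) (e + j).
  by move=> b; have := H 0%N; rewrite add0n; apply.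
elim: j i => [|j IH] i b; first by move: b; rewrite !addn0.
rewrite addnS; apply: (chain_bound_perm (t := [:: x * y, x ^+ i.+1 * y ^+ i.+1 &
    nseq j (x * y) ++ s])).
  exact/permPl/(perm_catCA [:: _] [:: _]).
apply: chain_bound_rot; apply: (chain_bound_perm (t := [:: x ^+ i.+1 * y ^+ i.+1, y * x &
    nseq j (x * y) ++ s])).
  exact/permPl/(perm_catCA [:: _] [:: _]).
apply: chain_bound_join; rewrite mulgA -(mulgA _ (y ^+ _) y) -expgSr.
apply: chain_bound_rot; rewrite mulgA -expgS; apply: IH.
by rewrite addSn -addnS.
Qed.

Lemma chain_bound_peel g x h s e :
  chain_bound (g * h :: x :: s) e -> chain_bound (g * x * h :: s) e.+1.
Proof.
move=> b; apply: chain_bound_rot; rewrite mulgA; apply: chain_bound_split.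
exact: chain_bound_rot b.
Qed.

(** Each factor [x] is cut off by a pair of pants, and the factors cut off merge into [x ^+ j] for
    free. *)
Lemma chain_bound_peel_power g x y h j s e :
  chain_bound (g * y ^+ j * h :: x ^+ j :: s) e ->
  chain_bound (g * (x * y) ^+ j * h :: s) (e + j).
Proof.
elim: j h s => [|j IH] h s b.
  rewrite addn0; rewrite expg0 !mulg1 in b *.
  apply: (chain_bound_drop1); apply: chain_bound_perm b.
  exact/permPl/(perm_catCA [:: _] [:: _]).
rewrite expgSr !mulgA addnS -(mulgA _ y h); apply: chain_bound_peel; apply: IH.
apply: (chain_bound_perm (t := [:: x ^+ j, x, g * y ^+ j * (y * h) & s])).
  by apply/seq.permP => P /=; do 3![move: (nat_of_bool (P _)) => ?]; move: (count P s); lia.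
apply: chain_bound_commute; first exact/commute_sym/commuteX/commute_refl.
rewrite -expgSr; apply: chain_bound_perm b.
rewrite (expgSr y) !mulgA; exact/permPl/(perm_catCA [:: _] [:: _]).
Qed.

Lemma chain_bound_expg g (ks : seq nat) s e :
  chain_bound (g ^+ sumn ks :: s) e -> chain_bound ([seq g ^+ i | i <- ks] ++ s) e.
Proof.
elim: ks s => [|i ks IH] s /= b; first by apply: chain_bound_drop1; rewrite expg0 in b.
apply: (chain_bound_perm (t := [seq g ^+ j | j <- ks] ++ g ^+ i :: s)).
  exact/permPl/(perm_catCA [:: _]).
apply: IH; apply: chain_bound_commute; first exact/commuteX2/commute_refl.
by rewrite -expgnDr addnC.
Qed.

(* The word is [(a * b * a^-1) * z] and also a conjugate of [U * v]; one half of
   its copies is joined in the first way and the other half in the second, the two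
   results are joined, and the outcome is cut into powers of [b] and of
   [c = a * b^-1 * a^-1], which cancel. *)
Lemma surgery_chain_bound a b m (q := m.+2) (n := q.+1) :
  chain_bound (nseq (2 * q) (a * b * a^-1 * b^-1 * a * b ^- n * a^-1 * b ^+ n)) (4 * q - 2).
Proof.
(* Opaque names make the group simplifications treat powers and long subwords as single letters. *)
have [c cdef] : exists c, a * b^-1 * a^-1 = c by eexists.
have [N NE] : exists N, b ^+ n = N by eexists.
have [Q QE] : exists Q, b ^+ q = Q by eexists.
have [cn cnE] : exists g, a * N^-1 * a^-1 = g by eexists.
have [cq cqE] : exists g, a * Q^-1 * a^-1 = g by eexists.
have cE k : c ^+ k = a * b ^- k * a^-1.
  have -> : c = b^-1 ^ a^-1 by rewrite -cdef conjgE invgK mulgA.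
  by rewrite -conjXg conjgE invgK expVgn mulgA.
have NQ : N = Q * b by rewrite -NE -QE expgSr.
have NQ' : N = b * Q by rewrite -NE -QE expgS.
have Nb : N * b^-1 = Q by rewrite NQ mulgK.
have bN : b * N^-1 = Q^-1 by rewrite NQ invgM mulVKg.
have bN' : b^-1 * N = Q by rewrite NQ' mulKg.
have [X XE] : exists g, (Q * cn) ^+ m = g by eexists.
have [Y YE] : exists g, (Q^-1 * a^-1 * N * a) ^+ m = g by eexists.
have ZE : (b^-1 * cn * N) ^+ q = b^-1 * cn * Q * cn * X * N.
  have H j : (b^-1 * cn * N) ^+ j.+1 = b^-1 * cn * (Q * cn) ^+ j * N.
    elim: j => [|j IH]; first by rewrite expg0 mulg1.
    by rewrite expgS IH (expgS (Q * cn)) !mulgA -(mulgA _ N b^-1) Nb.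
  by rewrite H (expgS (Q * cn)) XE !mulgA.
have UE : (N^-1 * a^-1 * N * a * b) ^+ q =
    N^-1 * a^-1 * N * a * Q^-1 * a^-1 * N * a * Y * b.
  have H j : (N^-1 * a^-1 * N * a * b) ^+ j.+1 =
      N^-1 * a^-1 * N * a * (Q^-1 * a^-1 * N * a) ^+ j * b.
    elim: j => [|j IH]; first by rewrite expg0 mulg1.
    by rewrite expgS IH (expgS (Q^-1 * _ * _ * _)) !mulgA -(mulgA _ b N^-1) bN.
  by rewrite H (expgS (Q^-1 * _ * _ * _)) YE !mulgA.
rewrite NE.
have [w wdef] : exists w, a * b * a^-1 * b^-1 * a * N^-1 * a^-1 * N = w by eexists.
rewrite wdef.
have -> : nseq (2 * q) w = nseq q w ++ nseq q w by rewrite -nseqD addnn mul2n.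
(* The budget: [m.+1] for merging each half of the copies, one for joining the two results, and the
   remaining [2 * q - 1] for cutting. *)
have -> : (4 * q - 2 = q.*2 + m.+1 + m.+1)%N by rewrite /q; lia.
have wE : w = a * b * a^-1 * (b^-1 * cn * N) by rewrite -wdef -cnE !mulgA.
rewrite {1}wE; apply: chain_bound_power_split.
have [U Udef] : exists U, N^-1 * a^-1 * N * a * b = U by eexists.
have [v vdef] : exists v, a^-1 * b^-1 * a = v by eexists.
have wE' : w = (U * v) ^ (N^-1 * a^-1 * N).
  by rewrite conjgE -wdef -Udef -vdef !gsimpl.
have W1E : (a * b * a^-1) ^+ q * (b^-1 * cn * N) ^+ q =
    a * Q * a^-1 * b^-1 * cn * Q * cn * X * N.
  have -> : a * b * a^-1 = b ^ a^-1 by rewrite conjgE invgK mulgA.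
  by rewrite ZE -conjXg conjgE invgK QE !mulgA.
rewrite W1E; set W1 := _ * N.
apply: (chain_bound_perm (t := [seq p.1 ^ p.2 | p <- (W1, 1) ::
    nseq q (U * v, N^-1 * a^-1 * N)])).
  by rewrite map_cons conjg1 map_nseq -wE'.
apply: chain_bound_conjs; rewrite map_cons map_nseq.
apply: (chain_bound_perm (t := nseq q (U * v) ++ [:: W1])).
  by rewrite -cat1s perm_catC.
apply: chain_bound_power_split.
have vE : v ^+ q = a^-1 * Q^-1 * a.
  have -> : v = b^-1 ^ a by rewrite -vdef conjgE mulgA.
  by rewrite -conjXg conjgE expVgn QE mulgA.
rewrite -/q vE.
have [Y1 Y1def] : exists g, N^-1 * a^-1 * X * N = g by eexists.
have [Y2 Y2def] : exists g, b^-1 * a * N^-1 = g by eexists.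
have [U1 U1def] : exists g, N^-1 * a^-1 * N = g by eexists.
have [U2 U2def] : exists g, N * a * Y * b = g by eexists.
have UqE : U ^+ q = U1 * a * Q^-1 * a^-1 * U2.
  by rewrite -Udef UE -U1def -U2def !mulgA.
apply: (chain_bound_rotate (h := Q^-1 * a * U ^+ q * a^-1)).
  by exists (U ^+ q * a^-1); rewrite conjgE !gsimpl.
apply: (chain_bound_perm (t := [:: W1; Q^-1 * a * U ^+ q * a^-1])).
  exact/permPl/(perm_catCA [:: _] [:: _] [::]).
apply: (chain_bound_rotate (h := a * Y1 * a * Q * a^-1 * Y2 * a^-1 * Q)).
  exists (a * Q * a^-1 * b^-1 * cn * Q).
  by rewrite conjgE /W1 -Y1def -Y2def -cnE !gsimpl.
have -> : q.*2 = (m + (m.+1)).+1.+2 by rewrite /q; lia.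
apply: chain_bound_join.
apply: (chain_bound_rotate (h := (U2 * Y1) * ((Y2 * U1) ^ (a * Q^-1 * a^-1)))).
  by exists (a * U2^-1); rewrite UqE !conjgE ?gsimpl.
apply: chain_bound_split.
apply: (chain_bound_perm (t := [:: (Y2 * U1) ^ (a * Q^-1 * a^-1); U2 * Y1])).
  exact/permPl/(perm_catCA [:: _] [:: _] [::]).
apply: chain_bound_conj.
have -> : Y2 * U1 = b^-1 * c ^+ (2 * n) * N.
  by rewrite -Y2def -U1def cE mul2n -addnn expgnDr NE !gsimpl.
apply: chain_bound_peel; rewrite bN'.
have -> : U2 * Y1 = N * (c ^+ q * N) ^+ m * c ^+ q * Q * (c ^+ n * Q) ^+ m * (Q^-1 * N).
  have YX : a * Y * Q^-1 * a^-1 = (c ^+ q * N) ^+ m * c ^+ q.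
    rewrite -YE cE QE; elim: (m) => [|j IH]; first by rewrite !expg0 mulg1 mul1g.
    by rewrite (expgSr (_ * a)) (expgSr (_ * N)) !mulgA IH !mulgA.
  have XQ : X = Q * (c ^+ n * Q) ^+ m * Q^-1.
    rewrite -XE -cnE cE NE; elim: (m) => [|j IH]; first by rewrite !expg0 mulg1 mulgV.
    by rewrite expgSr IH (expgSr (_ * Q)) !gsimpl.
  by rewrite -U2def -Y1def XQ -(mulgA N (_ ^+ m)) -YX !mulgA -(mulgA _ b) bN.
apply: (chain_bound_perm (t := [:: N * (c ^+ q * N) ^+ m * c ^+ q * Q * (c ^+ n * Q) ^+ m *
    (Q^-1 * N); Q; c ^+ (2 * n)])).
  by apply/seq.permP => P /=; do 3![move: (nat_of_bool (P _)) => ?]; lia.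
rewrite addnC; apply: chain_bound_peel_power.
rewrite -(mulgA _ Q) -(mulgA _ (Q * _)); apply: chain_bound_peel.
rewrite -[m]add0n; apply: chain_bound_peel_power; rewrite add0n -!expgnA.
(* $2q^2$ is the total exponent of the powers of [c], and equally of those of [b]. As [c] is
   conjugate to [b^-1], the two powers bound an annulus. *)
have [K KE] : exists k, (2 * (q * q) = k)%N by eexists.
apply: (chain_bound_perm (t := [seq c ^+ i | i <- [:: q * m; q; n * m; 2 * n]%N] ++
    [:: N * N ^+ m * (Q * Q ^+ m * (Q^-1 * N)); Q])).
  by apply/seq.permP => P /=; do 6![move: (nat_of_bool (P _)) => ?]; lia.
apply: chain_bound_expg; have -> : sumn [:: q * m; q; n * m; 2 * n]%N = K.
  by rewrite -KE /n /q /=; nia.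
apply: (chain_bound_perm (t := [:: N * N ^+ m * (Q * Q ^+ m * (Q^-1 * N)); Q; c ^+ K])).
  by apply/seq.permP => P /=; do 3![move: (nat_of_bool (P _)) => ?]; lia.
have -> : N * N ^+ m * (Q * Q ^+ m * (Q^-1 * N)) = b ^+ (n * m.+2 + q * m).
  have -> : Q * Q ^+ m = Q ^+ m * Q by rewrite -expgS expgSr.
  rewrite -!mulgA mulVKg.
  rewrite -NE -QE -!expgnA -!expgnDr -?expgS -?expgSr; congr (_ ^+ _); nia.
apply: chain_bound_commute; first by rewrite -QE; exact/commuteX2/commute_refl.
rewrite -QE -expgnDr; have -> : (n * m.+2 + q * m + q)%N = K.
  by rewrite -KE /n /q; nia.
apply: (chain_bound_rotate (h := (c ^+ K)^-1)).
  by exists a^-1; rewrite cE conjgE !gsimpl.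
apply: (chain_bound_perm (t := [:: c ^+ K; (c ^+ K)^-1])).
  exact/permPl/(perm_catCA [:: _] [:: _] [::]).
apply: chain_boundV; exact: chain_bound_nil.
Qed.

End SurgeryChain.

Lemma wval_nseq (F : groupType) (l : letter F) n : wval (nseq n l) = lval l ^+ n.
Proof. by elim: n => [|n IH]; rewrite ?[wval _]big_nil //= wval_cons IH expgS. Qed.

Section SurgeryWordValue.
Variables (F : groupType) (a b : F).

Lemma wval_surgery_word n : wval (surgery_word a b n) =
  a * b * a^-1 * b^-1 * a * b ^- n * a^-1 * b ^+ n.
Proof.
rewrite /surgery_word !(wval_cons, wval_cat, wval_nseq) /lval /= expVgn !mulgA.
by [].
Qed.

Lemma commutator_subgroup_surgery_word n : commutator_subgroup (wval (surgery_word a b n)).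
Proof.
apply/commutator_subgroupP; exists (1 + 1)%N; rewrite wval_surgery_word.
have -> : a * b * a^-1 * b^-1 * a * b ^- n * a^-1 * b ^+ n =
    [~ a^-1, b^-1] * [~ a^-1, b ^+ n] by rewrite !commgEl !conjgE !gsimpl.
by apply: commutator_productM; apply: commutator_product1.
Qed.

(** The ratio is $(4q-2)/(4q) = 1 - 1/(2q)$. Per copy of the word there are $2q + 8$ letters and at
    most $q + 2 + 1/q$ vertices, and Euler's formula gives $(2q+8)/4 - (q+2+1/q)/2 = 1 - 1/(2q)$
    from below. *)
Lemma surgery_word_stable_bounds (B : set F) m (q := m.+2) : free_basis B ->
  B a -> B b -> a != b ->
  stable_bounds (wval (surgery_word a b q.+1)) (2 * q) (4 * q - 2).
Proof.
move=> B_free Ba Bb ab; split=> //.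
  by apply: chain_bound_nseq; rewrite wval_surgery_word; apply: surgery_chain_bound.
move=> [|N] k //; rewrite -wval_power => ck.
have ow : over_basis B (surgery_word a b q.+1).
  move=> l; rewrite /surgery_word !(mem_cat, inE, mem_nseq).
  by case: l => x e /=; rewrite !xpair_eqE; do ?case: eqP => [->|_] //=; rewrite ?andbF.
have cw := surgery_word_cyclically_reduced ab (ltn0Sn q).
have [lab [tau [v [x [s [ps labs le]]]]]] := commutator_product_pairing B_free
  (over_basis_power ow) (reduced_power N.+1 cw) ck.
have := surgery_vertex_bound ab (ltn0Sn N) ps labs.
have sE : size s = (N.+1 * (q.+1.*2 + 6))%N.
  by rewrite -(size_map lab) labs size_flatten_nseq size_surgery_word.
move: le; rewrite {}sE /=.
move: (based_vertex_count v x s) => V.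
move: (N.+1) => M; rewrite -!muln2 /q; clear; nia.
Qed.

End SurgeryWordValue.

(** * Values modulo the integers *)

Local Open Scope classical_set_scope.
Local Open Scope card_scope.
Local Open Scope ring_scope.

Lemma toRmodZ_eq (R : realType) (x y : R) : x - y \is a Num.int -> toRmodZ x = toRmodZ y.
Proof.
by move=> xy; apply/eqP; rewrite -[_ == _]Quotient.idealrBE.
Qed.

Lemma scl_onto_QmodZ (R : realType) (F : groupType) (B : set F) a b (r : rat) :
  free_basis B -> B a -> B b -> a != b ->
  exists2 g : F, commutator_subgroup g & toRmodZ (scl R g) = toRmodZ (ratr r : R).
Proof.
move=> B_free Ba Bb ab.
have [d dE] : exists d : nat, denq r = d.+1%:Z.
  by exists `|denq r|.-1%N; rewrite prednK ?absz_gt0 ?denq_neq0 // absz_denq.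
(* For $r = p/D$ and $q = 2D$, the exponent $j = 4(D|p| - p)$ turns $j - j/(4D)$ into $j - |p| +
   p/D$; the term $D|p|$ keeps $j$ nonnegative. *)
pose j := (4 * `|(d.+1 * `|numq r|)%N%:Z - numq r|)%N.
have sb := stable_boundsX j (surgery_word_stable_bounds d.*2 B_free Ba Bb ab).
set w := wval _ in sb; have cw : commutator_subgroup (w ^+ j)%g.
  move: (commutator_subgroup_surgery_word a b d.*2.+3) => /commutator_subgroupP[k ck].
  by apply/commutator_subgroupP; exists (j * k)%N; apply: commutator_productX.
exists (w ^+ j)%g => //; rewrite (scl_stable_bounds R cw sb).
apply: toRmodZ_eq.
have -> : (j * (4 * d.*2.+2 - 2))%:R / (2 * (2 * d.*2.+2))%:R - ratr r =
    j%:R - `|numq r|%N%:R :> R.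
  have jE : j%:R = 4 * (d.+1%:R * `|numq r|%N%:R - (numq r)%:~R) :> R.
    rewrite natrM natr_absz ger0_norm; last first.
      rewrite subr_ge0 PoszM abszE; apply: le_trans (ler_norm _) _.
      by rewrite ler_peMl.
    by rewrite intrB -pmulrn natrM.
  have -> : ratr r = (numq r)%:~R / d.+1%:R :> R by rewrite /ratr dE -pmulrn.
  have E1 : (4 * d.*2.+2 - 2)%:R = 8 * d.+1%:R - 2 :> R.
    by rewrite natrB // -doubleS -muln2 !natrM; ring.
  have d0 : d.+1%:R != 0 :> R by rewrite pnatr_eq0.
  rewrite natrM E1 jE -doubleS -muln2 !natrM.
  move: (d.+1%:R) d0 => D D0; field.
  by rewrite D0.
by rewrite rpredB // intr_nat.
Qed.

Theorem mainTheorem2 (R : realType) (F : groupType) (B : set F)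
    (B_free : free_basis B) (rank_ge4 : `I_4 #<= B) :
  [set toRmodZ (scl R g) | g in @commutator_subgroup F]
  = [set toRmodZ (ratr q : R) | q in [set: rat]].
Proof.
apply/seteqP; split=> [_ [g cg <-]|_ [r _ <-]].
  have [N [e sb]] := scl_rational B_free cg.
  exists (e%:R / (2 * N)%:R) => //; rewrite (scl_stable_bounds R cg sb).
  by congr toRmodZ; rewrite fmorph_div !rmorph_nat.
have [a [b [Ba Bb ab]]] : exists a b, [/\ B a, B b & a != b].
  have /card_leP[f] := rank_ge4.
  pose i0 := SigSub (mem_set (isT : `I_4 0%N)); pose i1 := SigSub (mem_set (isT : `I_4 1%N)).
  exists (val (f i0)), (val (f i1)); split; [exact: set_valP..|].
  apply/eqP => /val_inj e01.
  suff : i0 = i1 by move/(congr1 val).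
  by apply: (@inj _ _ _ f); rewrite ?inE.
have [g cg gr] := scl_onto_QmodZ R r B_free Ba Bb ab; by exists g.
Qed.
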